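(* Let $I\subset\mathbb{R}$ be a bounded interval, $1<p<\infty$, $\delta\ge1$, and $w\in RH_p^{\delta}(I)$. Let $t^*=t^*(p,\delta)$ be the critical exponent defined in the context. Then for every $t\in[p,\infty)$, $$\sup_{J\subset I}\ \frac{\langle w^t\rangle_J^{1/t}}{\langle w\rangle_J}\le C_t(p,\delta),\qquad C_t(p,\delta)=\begin{cases}\dfrac{t^*-1}{t^*}\left(\dfrac{t^*}{t^*-t}\right)^{1/t}, & p\le t<t^*(p,\delta),\\[4pt] +\infty, & t\ge t^*(p,\delta),\end{cases}$$ where the supremum is over all subintervals $J\subset I$. Moreover the constant $C_t(p,\delta)$ is sharp: for fixed $I,p,\delta,t$, no smaller constant makes the inequality hold for all $w\in RH_p^{\delta}(I)$.
   Context: A weight on an interval $I$ is a non-negative measurable function on $I$. For a (bounded, non-degenerate) interval $J$, $|J|$ is its length and $\langle f\rangle_J=\frac{1}{|J|}\int_J f(s)\,ds$. For $1<p<\infty$ and $\delta\ge1$, $RH_p^{\delta}(I)$ is the class of weights $w$ on $I$ such that $0<\langle w\rangle_J<\infty$ and $\dfrac{\langle w^p\rangle_J^{1/p}}{\langle w\rangle_J}\le\delta$ for every subinterval $J\subset I$. For $\delta>1$, $t^*(p,\delta)$ is the unique solution $x>p$ of $\left(\dfrac{\delta x}{x-1}\right)^p\dfrac{x-p}{x}=1$. For $\delta=1$, $t^*(p,1)=+\infty$ and $C_t(p,1)$ is read as the limiting value $1$. *)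

(* Defs.v *)
From HB Require Import structures.
From mathcomp Require Import all_boot all_order all_algebra.
From mathcomp Require Import all_classical all_reals all_analysis.

Set Implicit Arguments.
Unset Strict Implicit.
Unset Printing Implicit Defensive.

Import Order.TTheory GRing.Theory Num.Theory.
Import numFieldNormedType.Exports.

Local Open Scope classical_set_scope.
Local Open Scope ring_scope.

(* Endpoints may or may not belong to the interval. *)
Definition bounded_interval (R : realType) (J : set R) : Prop :=
  [/\ is_interval J, bounded_set J & exists x y, [/\ J x, J y & x < y]].

Definition subinterval (R : realType) (I J : set R) : Prop :=
  bounded_interval J /\ J `<=` I.

(* The reals with the sigma-algebra of Lebesgue measurable sets, on which
   completed_lebesgue_measure is defined; measurableTypeR is the Borel one. *)
Definition lebesgue_measurableTypeR (R : realType) :=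
  caratheodory_type ((wlength (@idfun R))^*)%mu.

(* Extended-real valued, so that a divergent integral of a non-negative
   function yields +oo. *)
Definition mean (R : realType) (f : R -> R) (J : set R) : \bar R :=
  ((\int[@completed_lebesgue_measure R]_(s in J) (f s)%:E)
     / completed_lebesgue_measure J)%E.

Definition weight (R : realType) (I : set R) (w : R -> R) : Prop :=
  measurable_fun (I : set (lebesgue_measurableTypeR R)) w /\ (forall x, I x -> 0 <= w x).

Definition power_mean_ratio (R : realType) (p : R) (w : R -> R) (J : set R)
    : \bar R :=
  (mean (fun s => w s `^ p)%R J `^ p^-1 / mean w J)%E.

Definition RH (R : realType) (p delta : R) (I : set R) : set (R -> R) :=
  [set w | weight I w /\
    forall J, subinterval I J ->
      (0 < mean w J < +oo)%E /\ (power_mean_ratio p w J <= delta%:E)%E].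

Definition critical_equation (R : realType) (p delta x : R) : Prop :=
  p < x /\ (delta * x / (x - 1)) `^ p * ((x - p) / x) = 1.

(* For 1 < p and 1 < delta the critical equation has exactly one solution, since
   its left-hand side increases strictly from 0 at x = p to delta `^ p > 1 as x
   tends to +oo; the default value 0 of xget is then never used. *)
Definition critical_exponent (R : realType) (p delta : R) : \bar R :=
  if delta == 1 then +oo%E else (xget 0 [set x | critical_equation p delta x])%:E.

(* The branch 1 is the limit of the finite formula as the critical exponent
   tends to +oo, i.e. the value for delta = 1; -oo is never a critical
   exponent. *)
Definition sharp_constant (R : realType) (t p delta : R) : \bar R :=
  if critical_exponent p delta is ts%:E then
    if t < ts then ((ts - 1) / ts * (ts / (ts - t)) `^ t^-1)%:E else +oo%E
  else 1%E.

(* Main.v *)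
Require Import Defs.
From HB Require Import structures.
From mathcomp Require Import all_boot all_order all_algebra.
From mathcomp Require Import all_classical all_reals all_analysis.
From mathcomp Require Import measurable_realfun ring lra.

Import Order.TTheory GRing.Theory Num.Theory.
Import numFieldNormedType.Exports.

Local Open Scope classical_set_scope.
Local Open Scope ring_scope.

Set Implicit Arguments.
Unset Strict Implicit.
Unset Printing Implicit Defensive.

(** Write [x] for the critical exponent and [kappa = (x - 1) / x]; the critical
equation says that [delta^p (x - p) = kappa^p x].

Upper bound.  Let [v] be a Borel version of the weight on [[a, b]] and let
[lam] be at least its mean.  A variant of the rising sun lemma cuts [[a, b]]
into intervals on which the mean of [v] is exactly [lam] and short intervals on
which it is at most [lam].  On the former the reverse Hoelder inequality gives
[int kern p x m v <= 0] with [m = kappa lam], where [kern] is a combination of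
[v^p], [v] and [1] which is nonnegative for [v <= m] and nonpositive for
[m <= v <= lam].  By Lebesgue differentiation the short intervals are negligible
in the limit, so the integral of [kern p x m v] over [{v > m}] is nonpositive
for every [m] at least [kappa] times the mean of [v].  Integrating this against
[m^(t-p-1) dm] (Tonelli) bounds the integral of [v^t] for [t < x] by the sharp
constant; the truncation [v^p min(v, N)^(t-p)] makes all the integrals finite.
The choice of [kappa] makes every step an equality for [v s = (s - a)^(-1/x)].

Sharpness.  That power weight is in the class because, by Hoelder's inequality
for two terms, the ratio of means over [[c, d]] is largest at [c = a].  For
[delta = 1] the upper bound holds with every [x > t], and [x] tends to
infinity. *)

(** * Borel versions of Lebesgue measurable weights *)

Section Transfer.
Context {R : realType}.
Local Notation cmu := (@completed_lebesgue_measure R).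
Local Notation mu := (@lebesgue_measure R).
Local Notation LT := (lebesgue_measurableTypeR R).

Lemma borel_lebesgue (A : set R) :
  measurable A -> measurable (A : set LT).
Proof. move=> mA; exact: sub_caratheodory. Qed.

Lemma measurable_id_lebesgue : measurable_fun [set: LT] (idfun : LT -> R).
Proof. by move=> _ A mA; rewrite setTI; exact: borel_lebesgue. Qed.

Lemma measurable_fun_lebesgue d (T : measurableType d) (D : set R) (f : R -> T) :
  measurable D -> measurable_fun D f -> measurable_fun (D : set LT) (f : LT -> T).
Proof. by move=> mD mf _ A mA; exact: (borel_lebesgue (mf mD A mA)). Qed.

(** The identity from Lebesgue measurable to Borel sets pushes the completed measure forward to
    [lebesgue_measure], so this is a change of variables along the identity. *)
Lemma integral_completed_lebesgue (D : set R) (f : R -> \bar R) :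
  measurable D -> measurable_fun D f -> (forall x, D x -> (0 <= f x)%E) ->
  (\int[cmu]_(x in D) f x = \int[mu]_(x in D) f x)%E.
Proof.
move=> mD mf f0.
have mid : measurable_fun [set: LT] (idfun : LT -> measurableTypeR R).
  exact: measurable_id_lebesgue.
pose g : {mfun LT >-> measurableTypeR R} := HB.pack (idfun : LT -> measurableTypeR R)
  (@isMeasurableFun.Build _ _ _ _ (idfun : LT -> measurableTypeR R) mid).
have /= H := @ge0_integral_pushforward _ _ LT (measurableTypeR R) R idfun
  mid cmu D f mD mf.
rewrite preimage_id in H; rewrite -{}H; last by move=> y /set_mem; exact: f0.
have := @eq_measure_integral _ (measurableTypeR R) R D mu (pushforward cmu g) f.
by apply.
Qed.

Lemma lebesgue_measurable_borel (A : set LT) : measurable A ->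
  exists B N : set R, [/\ measurable B, measurable N, mu N = 0%E & A `\` N = B `\` N].
Proof.
move=> mA.
have := (@completed_caratheodory_measurable R).
rewrite g_sigma_completed_algebra_genE => /(congr1 (fun S => S A)) /= E.
have : ((wlength idfun)^*)%mu.-cara.-measurable A by exact: mA.
rewrite -E => -[B mB [N negN <-]]; case: negN => M [mM M0 NM].
exists B, M; split => //.
apply/seteqP; split => x /=; last by move=> [Bx nM]; split => //; left.
by move=> [[//|/NM Mx]].
Qed.

(** Superlevel sets at rational thresholds are countably many, so one Borel null set [N] collects
    all their exceptional parts; [w], set to zero off [D] minus [N], is then Borel. *)
Lemma lebesgue_measurable_borel_fun (D : set R) (w : R -> R) :
  measurable D -> measurable_fun (D : set LT) w -> (forall x, D x -> 0 <= w x) ->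
  exists v : R -> R, [/\ measurable_fun setT v, forall x, 0 <= v x &
    exists N : set R, [/\ measurable N, mu N = 0%E &
      forall x, D x -> ~ N x -> v x = w x]].
Proof.
move=> mD mw w0.
(* An enumeration of the rationals; codes that decode to nothing give 0, which merely repeats a
   threshold. *)
pose r_ n : R := ratr (odflt 0 (unpickle n)).
have mA n : exists BN : set R * set R, [/\ measurable BN.1, measurable BN.2,
    mu BN.2 = 0%E & (D `&` w @^-1` `]r_ n, +oo[) `\` BN.2 = BN.1 `\` BN.2].
  have /lebesgue_measurable_borel[B [N [? ? ? ?]]] :
    measurable ((D : set LT) `&` w @^-1` `]r_ n, +oo[).
    by apply: mw => //; exact: borel_lebesgue.
  by exists (B, N).
have {mA} [BN hBN] := choice mA.
pose N := \bigcup_n (BN n).2.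
have mN : measurable N by apply: bigcupT_measurable => n; have [] := hBN n.
have N0 : mu N = 0%E.
  apply/negligibleP => //; apply: negligible_bigcup => n.
  by apply/negligibleP; have [] := hBN n.
exists (w \_ (D `\` N)); split.
- apply/(measurable_restrictT _ _).1; first exact: measurableD.
  move=> mDN; apply: (measurability _ (RGenOInfty.measurableE R)) => //.
  move=> _ [_ [x ->] <-].
  have -> : (D `\` N) `&` w @^-1` `]x, +oo[ =
    \bigcup_n (if x < r_ n then ((BN n).1 `\` (BN n).2) `\` N else set0).
    apply/seteqP; split => [y [[Dy nNy]]|y [n _]]; rewrite /= ?in_itv/= ?andbT.
    + move=> /rat_in_itvoo[q]; rewrite inE => /= /itvP xqw.
      exists (pickle q) => //; rewrite /r_ pickleK/= xqw.
      have [_ _ _ <-] := hBN (pickle q).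
      split; last by [].
      split; last by move=> ?; apply: nNy; exists (pickle q).
      by split => //=; rewrite in_itv/= /r_ pickleK/= xqw.
    + case: ifPn => // xr; have [_ _ _ <-] := hBN n.
      move=> [[[Dy /=]]]; rewrite in_itv/= andbT => ry _ nN.
      by do !split => //; exact: lt_trans xr ry.
  apply: bigcupT_measurable => n; case: ifPn => // _.
  by have [? ? _ _] := hBN n; do !apply: measurableD.
- by move=> x; rewrite patchE; case: ifPn => // /set_mem[/w0].
- exists N; split => // x Dx nN; rewrite patchE ifT//; exact/mem_set.
Qed.
End Transfer.

(** * The kernel *)

Section Scalar.
Context {R : realType}.
Implicit Types p x w m l u : R.

(** Young's inequality for [w] and m^(p-1) with exponents [p] and p/(p-1), rearranged into the
    tangent line of the power at [m]. *)
Lemma powR_tangent p w m : 1 < p -> 0 <= w -> 0 < m ->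
  m `^ p + p * m `^ (p - 1) * (w - m) <= w `^ p.
Proof.
move=> p1 w0 m0; have p0 : 0 < p by lra.
have q0 : 0 < p / (p - 1) by rewrite divr_gt0//; lra.
have := @conjugate_powR R w (m `^ (p - 1)) p (p / (p - 1)) w0 (powR_ge0 _ _) p0 q0.
have -> : p^-1 + (p / (p - 1))^-1 = 1 by field; apply/andP; split; apply/eqP; lra.
move=> /(_ erefl).
rewrite -powRrM (_ : (p - 1) * (p / (p - 1)) = p); last by field; apply/eqP; lra.
have E : m `^ p = m * m `^ (p - 1) by rewrite mulr_powRB1// ltW.
have -> : w `^ p / p + m `^ p / (p / (p - 1)) = (w `^ p + m `^ p * (p - 1)) / p.
  by field; apply/andP; split; apply/eqP; lra.
rewrite ler_pdivlMr// E; set M := m `^ (p - 1); lra.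
Qed.

(* With [l = m * x / (x - 1)] and [D = ((x - 1) / x)^p * x / (x - p)] this is
   [(x - p) * (w^p - D * l^p - p * D * l^(p - 1) * (w - l))], a multiple of
   [w^p - D * l^p] up to a term whose integral vanishes where [w] has mean [l];
   the slope is the one for which it vanishes at [w = m]. *)
Definition kern p x m w : R :=
  (x - p) * w `^ p - p * (x - 1) * m `^ (p - 1) * w + x * (p - 1) * m `^ p.

(** Since x - p > 0, [kern] is convex in its last argument and lies above its tangent line at
    [w]. *)
Lemma kern_tangent p x m w z : 1 < p -> p < x -> 0 <= z -> 0 < w ->
  kern p x m w + (p * (x - p) * w `^ (p - 1) - p * (x - 1) * m `^ (p - 1)) * (z - w)
  <= kern p x m z.
Proof.
move=> p1 px z0 w0; have := @powR_tangent p z w p1 z0 w0; rewrite /kern.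
rewrite -subr_ge0 => /(mulr_ge0 (_ : 0 <= x - p)) => /(_ ltac:(lra)).
by set W := w `^ p; set Z := z `^ p; set M := m `^ p; set M' := m `^ (p - 1); lra.
Qed.

Lemma kern_diag p x m : 0 < p -> 0 < m -> kern p x m m = 0.
Proof.
by move=> p0 m0; rewrite /kern -(@mulr_powRB1 _ m p)// ?ltW//; ring.
Qed.

(** [kern] vanishes at [m] with slope p(1-p)m^(p-1) < 0, so its tangent there is already nonnegative
    to the left of [m]. *)
Lemma kern_ge0 p x m w : 1 < p -> p < x -> 0 < m -> 0 <= w <= m -> 0 <= kern p x m w.
Proof.
move=> p1 px m0 /andP[w0 wm].
apply: le_trans (@kern_tangent p x m m w p1 px w0 m0).
rewrite kern_diag//; last lra.
rewrite add0r -mulrBl mulr_le0//; last by rewrite subr_le0.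
by rewrite nmulr_rle0 ?powR_ge0//; nra.
Qed.

(** At l = mx/(x-1) the linear and constant terms add up to -x m^p, and m = l(x-1)/x turns the
    hypothesis into (x-p) l^p <= x m^p. *)
Lemma kern_top p x m : 1 < p -> p < x -> 0 < m ->
  x - p <= ((x - 1) / x) `^ p * x -> kern p x m (m * x / (x - 1)) <= 0.
Proof.
move=> p1 px m0 D1; rewrite /kern.
have x1 : 0 < x - 1 by lra.
have x0 : 0 < x by lra.
have -> : p * (x - 1) * m `^ (p - 1) * (m * x / (x - 1)) = p * x * m `^ p.
  by rewrite -(@mulr_powRB1 _ m p)//; [field; apply/eqP; lra|lra|lra].
suff : (x - p) * (m * x / (x - 1)) `^ p <= x * m `^ p by set M := m `^ p; lra.
have -> : m `^ p = ((x - 1) / x) `^ p * (m * x / (x - 1)) `^ p.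
  rewrite -powRM ?divr_ge0 ?mulr_ge0//; try lra.
  by congr powR; field; apply/andP; split; apply/eqP; lra.
by rewrite mulrA [x * _]mulrC; apply: ler_wpM2r => //; exact: powR_ge0.
Qed.

(** By convexity it suffices to look at the two ends. A positive value at [w] would force the
    tangent slope there to be positive, seen from [m], and negative, seen from the other end. *)
Lemma kern_le0 p x m w : 1 < p -> p < x -> 0 < m ->
  x - p <= ((x - 1) / x) `^ p * x ->
  m <= w <= m * x / (x - 1) -> kern p x m w <= 0.
Proof.
move=> p1 px m0 D1 /andP[mw wl]; rewrite leNgt; apply/negP => k0.
have w0 : 0 < w by lra.
have := @kern_tangent p x m w m p1 px (ltW m0) w0.
have := @kern_tangent p x m w (m * x / (x - 1)) p1 px (ltac:(lra)) w0.
have := kern_top p1 px m0 D1.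
rewrite (@kern_diag p x m)//; last lra.
set l := m * x / (x - 1) in wl *; set s := (_ - _) => kl H1 H2.
have h1 : s * (m - w) < 0 by lra.
have h2 : s * (l - w) < 0 by lra.
have s0 : 0 < s by nra.
nra.
Qed.

End Scalar.

(** * Rising sun decomposition and level sets *)

Section Partition.
Context {R : realType}.

(* A rising sun lemma with finitely many intervals, stated as an induction
   principle: by the intermediate value theorem one can either finish or cut off
   an interval of length [e], or a longer one with equal end values. *)
Lemma interval_partition_ind (F : R -> R) (a b e : R) (P : R -> R -> Prop) :
  0 < e -> a <= b -> {within `[a, b], continuous F} -> F b <= F a ->
  (forall c, P c c) ->
  (forall c d f, c <= d -> d <= f -> P c d -> P d f -> P c f) ->
  (forall c d, a <= c -> c < d -> d <= b -> F c = F d -> P c d) ->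
  (forall c d, a <= c -> c < d -> d <= b -> d - c <= e -> F d <= F c -> P c d) ->
  P a b.
Proof.
move=> e0 ab cF Fba P0 Padd Peq Pshort.
have IVTF c d y : a <= c -> c <= d -> d <= b ->
    Num.min (F c) (F d) <= y <= Num.max (F c) (F d) ->
    exists2 s, c <= s <= d & F s = y.
  move=> ac cd db yF; have [|s] := @IVT R F c d y cd _ yF.
    by apply: continuous_subspaceW cF => z /=; rewrite !in_itv/=; lra.
  by rewrite in_itv/=; exists s.
have {Peq} Peq c d : a <= c -> c <= d -> d <= b -> F c = F d -> P c d.
  by rewrite [in X in _ -> X]le_eqVlt => ac /predU1P[->//|cd] db; exact: Peq.
have {Pshort} Pshort c d : a <= c -> c <= d -> d <= b -> d - c <= e ->
    F d <= F c -> P c d.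
  by rewrite [in X in _ -> X]le_eqVlt => ac /predU1P[->//|cd] db; exact: Pshort.
(* Induction on the number of steps of length [e] needed to reach [b]; the invariant [F b <= F c]
   makes the intermediate value theorem applicable at each cut. *)
suff H n c : a <= c -> c <= b -> F b <= F c -> b - c <= n%:R * e -> P c b.
  have ba0 : 0 <= (b - a) / e by rewrite divr_ge0// ?(ltW e0)//; lra.
  have := archi_boundP ba0; rewrite ltr_pdivrMr// => /ltW.
  exact: H.
elim: n c => [|n IH] c ac cb Fbc.
  rewrite mul0r => bc; have -> : c = b by lra.
  exact: P0.
rewrite -natr1 mulrDl mul1r => bcn.
have [bce|bce] := leP (b - c) e; first exact: Pshort.
have [Fce|Fce] := leP (F (c + e)) (F c).
- have [Fbce|Fbce] := leP (F b) (F (c + e)).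
    apply: (Padd _ (c + e)); [lra|lra| |].
      by apply: Pshort => //; lra.
    by apply: IH => //; lra.
  (* [F] drops below [F b] within the step: cutting where it equals [F b] leaves a single piece with
     equal end values up to [b]. *)
  have [||||s cs Fs] := IVTF c (c + e) (F b); [lra|lra|lra| |].
    by rewrite ge_min le_max Fbc (ltW Fbce) orbT.
  apply: (Padd _ s); [lra|lra| |].
    by apply: Pshort => //; lra.
  by apply: Peq => //; lra.
(* [F] has risen above [F c] and must come back to it; the piece with equal end values has length at
   least [e], which the induction needs. *)
- have [||||s cs Fs] := IVTF (c + e) b (F c); [lra|lra|lra| |].
    by rewrite ge_min le_max Fbc (ltW Fce) orbT.
  apply: (Padd _ s); [lra|lra| |].
    by apply: Peq => //; lra.
  by apply: IH => //; lra.
Qed.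
End Partition.

Section LebPoint.
Context {R : realType}.
Local Notation mu := (@lebesgue_measure R).

Lemma fine_lebesgue_itv_oc (c d : R) : c <= d -> fine (mu `]c, d]) = d - c.
Proof.
rewrite lebesgue_measure_itv/= lte_fin le_eqVlt => /predU1P[->|->]//.
by rewrite ltxx subrr.
Qed.

Lemma integrable_cst_itv (b1 b2 : bool) (c d r : R) :
  mu.-integrable [set` Interval (BSide b1 c) (BSide b2 d)] (EFin \o cst r).
Proof.
apply: measurable_bounded_integrable => //.
- rewrite [X in (X < _)%E]lebesgue_measure_itv/= lte_fin; case: ifPn => // _.
  by rewrite -EFinB ltry.
- exists `|r|; split; first exact: num_real.
  by move=> x /ltW rx y _; exact: rx.
Qed.

(** Lebesgue points control centred balls. An interval containing [s] lies in the ball of radius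
    2(d-c), of length 4(d-c), so a mean deviation below (f s - l)/8 on the ball costs less than half
    the gap on the interval. *)
Lemma lebesgue_pt_mean_gt (f : R -> R) (s l : R) : mu.-integrable setT (EFin \o f) ->
  lebesgue_pt f s -> l < f s ->
  exists2 e : R, 0 < e & forall c d, c < d -> c <= s <= d -> d - c <= e ->
    l * (d - c) < \int[mu]_(x in `]c, d]) f x.
Proof.
move=> intf fs lfs; pose eta := (f s - l) / 8.
have eta0 : 0 < eta by rewrite /eta divr_gt0//; lra.
have := fs [set y | (y < eta%:E)%E].
have : nbhs (0 : \bar R)%E [set y | (y < eta%:E)%E].
  by apply: open_nbhs_nbhs; split; [exact: open_ereal_lt_ereal|rewrite /= lte_fin].
move=> /[swap] /[apply] -[e /= e0 He].
exists (e / 4) => [|c d cd /andP[cs sd] dce]; first by rewrite divr_gt0.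
pose r := 2 * (d - c).
have r0 : 0 < r by rewrite /r; lra.
have := He r; rewrite /ball/= sub0r normrN gtr0_norm// => /(_ _ r0) h.
have {}h : (davg f s r < eta%:E)%E by apply: h; rewrite /r; lra.
have intc : mu.-integrable `]c, d] (EFin \o f) by exact: integrableS intf.
have intk k : mu.-integrable `]c, d] (EFin \o cst k) by exact: integrable_cst_itv.
have intfk : mu.-integrable `]c, d] (EFin \o (fun x => f x - f s)).
  exact: (integrableB _ intc (intk (f s))).
have E : \int[mu]_(x in `]c, d]) (f x - f s) =
    \int[mu]_(x in `]c, d]) f x - f s * (d - c).
  rewrite RintegralB//=; last exact: (intk (f s)).
  by rewrite Rintegral_cst// fine_lebesgue_itv_oc// ltW.
have N : `|\int[mu]_(x in `]c, d]) (f x - f s)| < eta * (r *+ 2).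
  rewrite -lte_fin EFin_normr_Rintegral//.
  apply: (@le_lt_trans _ _ (\int[mu]_(x in ball s r) `|(f x - f s)%:E|)%E).
    apply: le_trans (le_abse_integral _ _ _) _ => //=.
      by case/integrableP: intfk.
    apply: ge0_subset_integral => //=.
    - exact: measurable_ball.
    - apply/measurable_EFinP; apply: measurableT_comp => //; apply: measurable_funB => //.
      by apply: measurable_funTS; case/integrableP: intf => /measurable_EFinP.
    - by move=> x /=; rewrite in_itv/= ball_itv/= in_itv/= /r; lra.
  move: h; rewrite /davg /iavg lebesgue_measure_ball ?ltW// => h.
  rewrite EFinM -lte_pdivrMr ?mulrn_wgt0//.
  by rewrite muleC; rewrite inver mulrn_eq0/= gt_eqF// in h.
move: N; rewrite ltr_norml E => /andP[+ _].
set I := \int[_]_(_ in _) _; move: I => I {E}.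
have : 0 < (f s - l) * (d - c) by rewrite mulr_gt0//; lra.
rewrite /eta /r mulr2n; lra.
Qed.
End LebPoint.

(** * The kernel inequality at a single level *)

Section Level.
Context {R : realType}.
Local Notation mu := (@lebesgue_measure R).
Variables (v : R -> R) (a b p x m : R).
Hypotheses (mv : measurable_fun setT v) (v0 : forall s, 0 <= v s)
  (iv : mu.-integrable `[a, b] (EFin \o v))
  (ivp : mu.-integrable `[a, b] (EFin \o (fun s => v s `^ p)))
  (ab : a < b) (p1 : 1 < p) (px : p < x) (m0 : 0 < m)
  (D1 : x - p <= ((x - 1) / x) `^ p * x)
  (RHv : forall c d, a <= c -> c < d -> d <= b ->
    (x - p) * \int[mu]_(s in `]c, d]) v s `^ p <=
      x * (((x - 1) / x) * (\int[mu]_(s in `]c, d]) v s / (d - c))) `^ p * (d - c))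
  (mean_le : \int[mu]_(s in `]a, b]) v s <= m * x / (x - 1) * (b - a)).

Let lam := m * x / (x - 1).
Let k s := kern p x m (v s).
Let H s := if m < v s then k s else 0.
Let Hp s := Num.max (H s) 0.

Let subab c d : a <= c -> d <= b -> `]c, d]%classic `<=` `[a, b]%classic.
Proof. by move=> ac db z /=; rewrite !in_itv/=; lra. Qed.

Let intv c d : a <= c -> d <= b -> mu.-integrable `]c, d] (EFin \o v).
Proof. by move=> ac db; apply: integrableS iv => //; exact: subab. Qed.

Let intvp c d : a <= c -> d <= b -> mu.-integrable `]c, d] (EFin \o (fun s => v s `^ p)).
Proof. by move=> ac db; apply: integrableS ivp => //; exact: subab. Qed.

Let mvp : measurable_fun setT (fun s => v s `^ p).
Proof. exact: (measurableT_comp (@measurable_powR R p)). Qed.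

Let kE : k = (fun s => ((x - p) * v s `^ p - (p * (x - 1) * m `^ (p - 1)) * v s)
  + x * (p - 1) * m `^ p).
Proof. by []. Qed.

Let mk : measurable_fun setT k.
Proof.
rewrite kE; apply: measurable_funD => //; apply: measurable_funB.
  by apply: measurable_funM.
by apply: measurable_funM.
Qed.

Let intk_aux c d : a <= c -> d <= b ->
  mu.-integrable `]c, d] (EFin \o (fun s => (x - p) * v s `^ p)) /\
  mu.-integrable `]c, d] (EFin \o (fun s => (p * (x - 1) * m `^ (p - 1)) * v s)).
Proof.
move=> ac db; split.
  by apply: (integrableZl _ (x - p) (intvp ac db)).
by apply: (integrableZl _ (p * (x - 1) * m `^ (p - 1)) (intv ac db)).
Qed.

Let intk c d : a <= c -> d <= b -> mu.-integrable `]c, d] (EFin \o k).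
Proof.
move=> ac db; have [i1 i2] := intk_aux ac db.
exact: (integrableD _ (integrableB _ i1 i2)
  (integrable_cst_itv false false c d (x * (p - 1) * m `^ p))).
Qed.

Let Rintk c d : a <= c -> c <= d -> d <= b ->
  \int[mu]_(s in `]c, d]) k s = (x - p) * \int[mu]_(s in `]c, d]) v s `^ p
    - p * (x - 1) * m `^ (p - 1) * \int[mu]_(s in `]c, d]) v s
    + x * (p - 1) * m `^ p * (d - c).
Proof.
move=> ac cd db; have [i1 i2] := intk_aux ac db.
rewrite kE RintegralD//; last 2 first.
- exact: (integrableB _ i1 i2).
- exact: integrable_cst_itv.
rewrite RintegralB// RintegralZl//; last exact: intvp.
rewrite RintegralZl//; last exact: intv.
by rewrite Rintegral_cst// fine_lebesgue_itv_oc.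
Qed.

(** With mean [lam] the linear term of [kern] averages to p x m^p, and [RHv] bounds the average of
    the power term by x m^p because lam(x-1)/x = m; the three terms then sum to at most 0. *)
Let k_eq c d : a <= c -> c < d -> d <= b ->
  \int[mu]_(s in `]c, d]) v s = lam * (d - c) -> \int[mu]_(s in `]c, d]) k s <= 0.
Proof.
have x1 : 0 < x - 1 by rewrite subr_gt0 (lt_trans p1).
have x0 : 0 < x by rewrite (lt_trans _ px)// (lt_trans _ p1).
have p0 : 0 < p by rewrite (lt_trans _ p1).
move=> ac cd db E; rewrite Rintk ?(ltW cd)//; have := RHv ac cd db.
have dc : 0 < d - c by rewrite subr_gt0.
rewrite E mulfK ?gt_eqF//.
have -> : (x - 1) / x * lam = m by rewrite /lam; field; rewrite !gt_eqF.
have -> : p * (x - 1) * m `^ (p - 1) * (lam * (d - c)) = p * x * m `^ p * (d - c).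
  rewrite -(@mulr_powRB1 _ m p)//; last exact: ltW.
  by rewrite /lam; field; rewrite gt_eqF.
set I := \int[_]_(_ in _) _; set M := m `^ p => I_le.
have -> : x * (p - 1) * M * (d - c) = p * x * M * (d - c) - x * M * (d - c) by ring.
by rewrite addrA subrK subr_le0.
Qed.

Let H_le s : H s <= k s.
Proof.
rewrite /H; case: ltP => // vm; apply: kern_ge0 => //.
by rewrite v0.
Qed.

Let mH : measurable_fun setT H.
Proof. by apply: measurable_fun_ifT => //; exact: measurable_fun_ltr. Qed.

Let intH c d : a <= c -> d <= b -> mu.-integrable `]c, d] (EFin \o H).
Proof.
move=> ac db; apply: (le_integrable _ _ _ (intk ac db)) => //.
  by apply: measurable_funTS; exact/measurable_EFinP.
move=> s _ /=; rewrite lee_fin /H; case: ifPn => // _.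
by rewrite normr0.
Qed.

Let mHp : measurable_fun setT Hp.
Proof. exact: measurable_maxr. Qed.

Let Hp0 s : 0 <= Hp s. Proof. by rewrite /Hp le_max lexx orbT. Qed.
Let H_Hp s : H s <= Hp s. Proof. by rewrite /Hp le_max lexx. Qed.

Let intHp : mu.-integrable `]a, b] (EFin \o Hp).
Proof.
apply: (le_integrable _ _ _ (intH (lexx a) (lexx b))) => //.
  by apply: measurable_funTS; exact/measurable_EFinP.
move=> s _ /=; rewrite lee_fin ger0_norm//.
by rewrite /Hp ge_max ler_norm normr_ge0.
Qed.

Let Hp_eq0 s : v s <= lam -> Hp s = 0.
Proof.
move=> vl; apply/max_idPr; rewrite /H; case: ifPn => // mvs.
by apply: kern_le0 => //; rewrite (ltW mvs).
Qed.

(** Increments of [F] integrate v - lam: equal end values mean that [v] has mean [lam], a decrease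
    that its mean is at most [lam]. *)
Let F s := \int[mu]_(u in `[a, s]) v u - lam * s.

Let FB c d : a <= c -> c <= d -> d <= b ->
  F d - F c = \int[mu]_(s in `]c, d]) v s - lam * (d - c).
Proof.
move=> ac cd db; rewrite /F.
have <- := @Rintegral_itvB R v (BLeft a) (BRight d) c; [ring| | |].
- by apply: integrableS iv => // z /=; rewrite !in_itv/=; lra.
- by rewrite bnd_simp.
- by rewrite bnd_simp.
Qed.

Let cF : {within `[a, b], continuous F}.
Proof.
have c1 := parameterized_integral_continuous (ltW ab) iv.
have c2 : {within `[a, b], continuous ( *%R lam)}.
  by apply: continuous_subspaceT => z; apply: cvgM; [exact: cvg_cst|exact: cvg_id].
by move=> s; exact: (cvgB (c1 s) (c2 s)).
Qed.

Let FabE : F b <= F a.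
Proof. by rewrite -subr_le0 FB ?lexx ?(ltW ab)// subr_le0. Qed.

Let short_low e s := exists c d, [/\ a <= c, c < d, d <= b, c <= s <= d &
  d - c <= e /\ \int[mu]_(s in `]c, d]) v s <= lam * (d - c)].

(** Rising sun induction, with [D] collecting the short pieces. On a piece of mean [lam], [H_le] and
    [k_eq] make the integral of [H] nonpositive; on a short one [H] is bounded by its positive
    part. *)
Let short_low_set e : 0 < e -> exists D, [/\ measurable D, D `<=` `]a, b]%classic,
  forall s, D s -> short_low e s &
  \int[mu]_(s in `]a, b]) H s <= \int[mu]_(s in D) Hp s].
Proof.
move=> e0; pose P c d := a <= c -> c <= d -> d <= b -> exists D,
  [/\ measurable D, D `<=` `]c, d]%classic, forall s, D s -> short_low e s &
  \int[mu]_(s in `]c, d]) H s <= \int[mu]_(s in D) Hp s].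
suff : P a b by apply => //; exact: ltW.
apply: (interval_partition_ind e0 (ltW ab) cF FabE).
- move=> c _ _ _; exists set0; split => //.
  by rewrite set_itvoc0// !Rintegral_set0.
- move=> c d f cd df Pcd Pdf ac cf fb.
  have [|||D [mD DS DE DI]] := Pcd; [lra|lra|lra|].
  have [|||D' [mD' DS' DE' DI']] := Pdf; [lra|lra|lra|].
  exists (D `|` D'); split.
  + exact: measurableU.
  + by move=> s [/DS|/DS'] /=; rewrite !in_itv/=; lra.
  + by move=> s [/DE|/DE'].
  + have -> : `]c, f]%classic = `]c, d] `|` `]d, f].
      by rewrite -itv_bndbnd_setU//= bnd_simp.
    rewrite Rintegral_setU//; last 2 first.
    * rewrite -itv_bndbnd_setU//= ?bnd_simp//; apply: intH; lra.
    * rewrite disj_set2E; apply/eqP/seteqP; split => // s [] /=.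
      rewrite !in_itv/= => /andP[_ h1] /andP[h2 _].
      by have := lt_le_trans h2 h1; rewrite ltxx.
    rewrite Rintegral_setU//; last 2 first.
    * apply: integrableS intHp => //; first exact: measurableU.
      by move=> s [/DS|/DS'] /=; rewrite !in_itv/=; lra.
    * rewrite disj_set2E; apply/eqP/seteqP; split => // s [/DS + /DS'] /=.
      rewrite !in_itv/= => /andP[_ h1] /andP[h2 _].
      by have := lt_le_trans h2 h1; rewrite ltxx.
    exact: lerD.
- move=> c d ac cd db Fcd _ _ _; exists set0; split => //.
  rewrite Rintegral_set0; apply: le_trans (k_eq ac cd db _).
    by apply: le_Rintegral => //; [exact: intH|exact: intk].
  by apply/eqP; rewrite -subr_eq0 -FB ?(ltW cd)// Fcd subrr.
- move=> c d ac cd db dce Fdc _ _ _; exists `]c, d]%classic; split => //.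
  + move=> s; rewrite /= in_itv/= => sd; exists c, d; split => //; first lra.
    by split => //; rewrite -subr_le0 -FB ?(ltW cd)// subr_le0.
  + apply: le_Rintegral => //; first exact: intH.
    by apply: integrableS intHp => //; move=> s /=; rewrite !in_itv/=; lra.
Qed.

(** Dominated convergence along e = 1/(n+1). [Hp] vanishes where v <= lam, and almost every point
    with v > lam eventually leaves the sets [D_ n], since at a Lebesgue point all short intervals
    containing it have mean above [lam]. *)
Lemma level_integral_le0 : \int[mu]_(s in `]a, b]) H s <= 0.
Proof.
have n0 (n : nat) : 0 < n.+1%:R^-1 :> R by rewrite invr_gt0 ltr0n.
have [D_ hD] := choice (fun n => short_low_set (n0 n)).
pose f_ n := (EFin \o Hp) \_ (D_ n).
have mf n : measurable_fun setT (f_ n).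
  apply/(measurable_restrictT _ _).1; first by have [] := hD n.
  by apply: measurable_funTS; exact/measurable_EFinP.
have vab : mu.-integrable setT (EFin \o (v \_ `[a, b])).
  by rewrite -restrict_EFin; apply/integrable_restrict => //; rewrite setTI.
have cvf : {ae mu, forall s, `]a, b]%classic s -> f_ n s @[n --> \oo] --> cst 0%E s}.
  have := lebesgue_differentiation (open_integrable_locally openT vab).
  apply: filterS; first exact: (ae_filter_ringOfSetsType mu).
  move=> s Ls; rewrite /= in_itv/= => /andP[as_ sb].
  have [vl|vl] := leP (v s) lam.
    rewrite (_ : f_^~ s = cst 0%E); first exact: cvg_cst.
    by apply/funext => n; rewrite /f_ patchE /= Hp_eq0// if_same.
  have vs : (v \_ `[a, b]) s = v s.
    by rewrite patchE mem_set//= in_itv/= sb ltW.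
  have vl' : lam < (v \_ `[a, b]) s by rewrite vs.
  have [e e0 he] := lebesgue_pt_mean_gt vab Ls vl'.
  apply: cvg_near_cst; near=> n; rewrite /f_ patchE; case: ifPn => // /set_mem sD.
  have [_ _ /(_ s sD)[c [d [ac cd db cs [dcn meanle]]]] _] := hD n.
  have : d - c <= e.
    apply: le_trans dcn _; apply: ltW; near: n.
    exact: near_infty_natSinv_lt (PosNum e0).
  move=> /(he c d cd cs); rewrite (@eq_Rintegral _ _ _ mu `]c, d]%classic v)//; last first.
    move=> z; rewrite inE /= in_itv/= => /andP[cz zd]; rewrite patchE mem_set//= in_itv/=.
    by rewrite (le_trans zd db) (le_trans ac (ltW cz)).
  by rewrite ltNge meanle.
have domf : {ae mu, forall s, forall n, `]a, b]%classic s ->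
    (`|f_ n s| <= (EFin \o Hp) s)%E}.
  apply: aeW; move=> z k0 _; rewrite /f_ patchE; case: ifPn => _.
    by rewrite /= ger0_norm.
  by rewrite abse0 lee_fin.
have [_ _] := @dominated_convergence _ _ _ mu _ (measurable_itv _) f_ (cst 0%E) _
  (fun n => measurable_funTS (mf n)) (measurable_cst 0%E) cvf intHp domf.
rewrite integral0 => cv0.
have HE : (\int[mu]_(s in `]a, b]) H s)%:E = (\int[mu]_(s in `]a, b]) (H s)%:E)%E.
  by rewrite /Rintegral fineK//; apply: integrable_fin_num => //; exact: intH.
rewrite -lee_fin; apply: (cvge_to_ge cv0); apply: nearW => n.
have [mD DS _ HI] := hD n.
have E : (\int[mu]_(s in `]a, b]) f_ n s = \int[mu]_(s in D_ n) (Hp s)%:E)%E.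
  by rewrite -[in RHS](setIidr DS) integral_mkcondr.
rewrite [leRHS]E.
rewrite -[leRHS]fineK ?lee_fin//.
by apply: integrable_fin_num => //; apply: integrableS intHp.
Unshelve. all: by end_near. Qed.
End Level.

(** * Integration over the levels *)

Section Trunc.
Context {R : realType}.
Local Notation mu := (@lebesgue_measure R).

Lemma is_derive_powR (r z : R) : 0 < z ->
  is_derive z 1 (fun s : R => s `^ r) (r * z `^ (r - 1)).
Proof.
move=> z0; have zI : z \in `]0, +oo[ by rewrite in_itv/= andbT.
apply: DeriveDef; first exact: derivable_powR.
by rewrite -derive1E powR_derive1.
Qed.

Lemma continuous_powR_gt0 (r z : R) : 0 < z -> {for z, continuous (fun s : R => s `^ r)}.
Proof.
move=> z0; apply: differentiable_continuous; apply/derivable1_diffP.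
by have [] := is_derive_powR r z0.
Qed.

Lemma integral_FTC_gt (g F : R -> R) (e c d : R) : e < c -> c <= d ->
  (forall z : R, e < z -> is_derive z 1 F (g z)) ->
  (forall z : R, e < z -> {for z, continuous g}) ->
  (\int[mu]_(m in `[c, d]) (g m)%:E = (F d - F c)%:E)%E.
Proof.
move=> ec; rewrite le_eqVlt => /predU1P[<- _ _|cd dF cg].
  by rewrite set_itv1 integral_set1 subrr.
have cF (z : R) : e < z -> {for z, continuous F}.
  move=> ez; apply: differentiable_continuous; apply/derivable1_diffP.
  by have [] := dF z ez.
rewrite (@continuous_FTC2 _ g F)//.
- apply: continuous_in_subspaceT => z; rewrite inE/= in_itv/= => /andP[cz _].
  by apply: cg; exact: lt_le_trans cz.
- split.
  + move=> z; rewrite in_itv/= => /andP[cz _].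
    by have [] := dF z (lt_trans ec cz).
  + by apply: cvg_at_right_filter; exact: cF.
  + by apply: cvg_at_left_filter; apply: cF; exact: lt_trans cd.
- move=> z; rewrite in_itv/= => /andP[cz _].
  by rewrite derive1E; have [] := dF z (lt_trans ec cz).
Qed.

Variables (p x t : R).
Let al := (x - 1) / (t - 1).
Let be := x / t.
Let ga := (x - p) / (t - p).
Let K := ga - p * al + (p - 1) * be.

(** The closed form shows that [K] is positive and that it tends to 0 as [t] approaches [x], which
    is where the final bound blows up. *)
Lemma trunc_coefE : 1 < p -> p < t -> t < x ->
  K = p * (p - 1) * (x - t) / (t * (t - 1) * (t - p)).
Proof.
move=> p1 pt tx.
have t0 : 0 < t by lra.
have t1 : 0 < t - 1 by lra.
have tp : 0 < t - p by lra.
by rewrite /K /ga /al /be; field; rewrite !gt_eqF.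
Qed.

Lemma powRD_gt0 (w r s : R) : 0 < w -> w `^ (r + s) = w `^ r * w `^ s.
Proof. by move=> w0; rewrite powRD//; apply/implyP => _; rewrite gt_eqF. Qed.

Lemma powR_mul_split (w r s : R) : 0 < w -> w `^ (r - s) * w `^ s = w `^ r.
Proof. by move=> w0; rewrite -powRD_gt0// subrK. Qed.

(* The right side minus the second term on the left is an antiderivative in [m]
   of [m `^ (t - p - 1) * kern p x m w], which is nonnegative for [m >= w]; at
   [m = w] the inequality is an equality. *)
Lemma kern_primitive_le w m : 1 < p -> p < t -> t < x ->
  0 <= w -> w <= m -> 0 < m ->
  K * w `^ t + p * al * (w * m `^ (t - 1)) <=
    ga * (w `^ p * m `^ (t - p)) + (p - 1) * be * m `^ t.
Proof.
move=> p1 pt tx.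
have t0 : 0 < t by lra.
have t1 : 0 < t - 1 by lra.
have tp : 0 < t - p by lra.
(* The case w = 0 is treated apart: the monotonicity argument on [w, m] differentiates powers and
   needs w > 0. *)
rewrite le_eqVlt => /predU1P[<- _ m0|w0 wm m0].
  rewrite !powR0 ?gt_eqF//; last lra.
  rewrite !(mul0r, mulr0, add0r) mulr_ge0 ?powR_ge0//.
  by rewrite mulr_ge0// /be ?divr_ge0//; lra.
have mono (F : R -> R) : (forall z : R, 0 < z ->
    is_derive z 1 F (z `^ (t - p - 1) * kern p x z w)) -> F w <= F m.
  move=> dF.
  have cF (z : R) : 0 < z -> {for z, continuous F}.
    by move=> z0; apply: differentiable_continuous; apply/derivable1_diffP; have [] := dF z z0.
  apply: (@ger0_derive1_ndecr _ F w m) => //.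
  - move=> z; rewrite in_itv/= => /andP[wz _].
    by have [] := dF z (lt_trans w0 wz).
  - move=> z; rewrite in_itv/= => /andP[wz zm].
    rewrite derive1E; have [_ ->] := dF z (lt_trans w0 wz).
    rewrite mulr_ge0 ?powR_ge0//; apply: kern_ge0 => //.
    + exact: lt_trans tx.
    + exact: lt_trans wz.
    + by rewrite !ltW.
  - apply: continuous_in_subspaceT => z; rewrite inE/= in_itv/= => /andP[cz _].
    by apply: cF; exact: lt_le_trans cz.
pose F m := ga * (w `^ p * m `^ (t - p)) - p * al * (w * m `^ (t - 1))
  + (p - 1) * be * m `^ t.
have dF (z : R) : 0 < z -> is_derive z 1 F (z `^ (t - p - 1) * kern p x z w).
  move=> z0.
  have h1 := is_derive_powR (t - p) z0.
  have h2 := is_derive_powR (t - 1) z0.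
  have h3 := is_derive_powR t z0.
  have -> : z `^ (t - p - 1) * kern p x z w = ga * (w `^ p * ((t - p) * z `^ (t - p - 1)))
      - p * al * (w * ((t - 1) * z `^ (t - 1 - 1))) + (p - 1) * be * (t * z `^ (t - 1)).
    have E2 : z `^ (t - 1 - 1) = z `^ (t - p - 1) * z `^ (p - 1).
      by rewrite -powRD_gt0//; congr powR; ring.
    have E3 : z `^ (t - 1) = z `^ (t - p - 1) * z `^ p.
      by rewrite -powRD_gt0//; congr powR; ring.
    rewrite E2 E3 /kern /ga /al /be.
    by field; rewrite !gt_eqF.
  exact: is_deriveD.
have := mono F dF.
rewrite /F.
have -> : w `^ p * w `^ (t - p) = w `^ t by rewrite mulrC powR_mul_split.
have -> : w * w `^ (t - 1) = w `^ t by rewrite mulr_powRB1// ltW.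
rewrite /K; set A := w `^ t; set B := _ * _ `^ _; set C := _ * _ `^ _.
by set D := m `^ t; lra.
Qed.

(** The counterpart above the truncation level. After cancelling the [ga] terms, the power of [w] is
    replaced by its tangent at [N]; equality holds at w = N, and the remaining slope is a
    nonnegative multiple of al - be, nonnegative because t < x. *)
Lemma trunc_tangent w N : 1 < p -> p < t -> t < x ->
  0 < N -> N <= w ->
  K * (w `^ p * N `^ (t - p)) + p * al * (w * N `^ (t - 1)) <=
    ga * (w `^ p * N `^ (t - p)) + (p - 1) * be * N `^ t.
Proof.
move=> p1 pt tx N0 Nw.
have t0 : 0 < t by lra.
have t1 : 0 < t - 1 by lra.
have abe : be <= al.
  rewrite /be /al ler_pdivrMr// mulrAC ler_pdivlMr//; lra.
have be0 : 0 < be by rewrite divr_gt0//; lra.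
have B0 : 0 <= p * al - (p - 1) * be.
  have : (p - 1) * be <= (p - 1) * al by rewrite ler_pM2l//; lra.
  by lra.
have := @powR_tangent R p w N p1 (ltW (lt_le_trans N0 Nw)) N0.
move=> /(ler_wpM2l B0) /(ler_wpM2r (powR_ge0 N (t - p))).
have E1 : N `^ p * N `^ (t - p) = N * N `^ (t - 1).
  by rewrite mulrC powR_mul_split// mulr_powRB1// ltW.
have E2 : N `^ (p - 1) * N `^ (t - p) = N `^ (t - 1).
  by rewrite -powRD_gt0//; congr powR; ring.
have -> : (p * al - (p - 1) * be) * (N `^ p + p * N `^ (p - 1) * (w - N)) * N `^ (t - p) =
   (p * al - (p - 1) * be) * (N * N `^ (t - 1) + p * N `^ (t - 1) * (w - N)).
  by rewrite -E1 -E2; ring.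
rewrite -[N `^ t]mulr_powRB1 ?(ltW N0)//.
have : 0 <= p * (p - 1) * (al - be) * (w - N) * N `^ (t - 1).
  by rewrite !mulr_ge0 ?powR_ge0 ?subr_ge0//; lra.
rewrite /K.
set A := N `^ (t - 1); set B := w `^ p; set C := N `^ (t - p); nra.
Qed.
End Trunc.

(** * Tonelli's theorem and integrals over the levels below a value *)

Section Tonelli.
Context {R : realType}.
Local Notation mu := (@lebesgue_measure R).

Lemma tonelli_swap (A B : set R) (P : R * R -> R) :
  measurable A -> measurable B -> measurable_fun setT P -> (forall z, 0 <= P z) ->
  (\int[mu]_(s in A) \int[mu]_(m in B) (P (s, m))%:E =
   \int[mu]_(m in B) \int[mu]_(s in A) (P (s, m))%:E)%E.
Proof.
move=> mA mB mP P0.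
pose f : R * R -> \bar R := (EFin \o P) \_ (A `*` B).
have mf : measurable_fun setT f.
  apply/(measurable_restrictT _ _).1; first exact: measurableX.
  by apply: measurable_funTS; exact/measurable_EFinP.
have f0 z : (0 <= f z)%E.
  by rewrite /f patchE; case: ifPn => // _; rewrite lee_fin.
have := @fubini_tonelli _ _ (measurableTypeR R) (measurableTypeR R) R mu mu f mf f0.
have -> : (\int[mu]_s \int[mu]_m f (s, m) =
    \int[mu]_(s in A) \int[mu]_(m in B) (P (s, m))%:E)%E.
  rewrite [RHS]integral_mkcond; apply: eq_integral => s _; rewrite patchE.
  case: ifPn => sA.
    rewrite [RHS]integral_mkcond; apply: eq_integral => m _; rewrite /f !patchE.
    by rewrite in_setX/= sA.
  rewrite integral0_eq// => m _; rewrite /f patchE in_setX/= (negbTE sA)//.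
have -> : (\int[mu]_m \int[mu]_s f (s, m) =
    \int[mu]_(m in B) \int[mu]_(s in A) (P (s, m))%:E)%E.
  rewrite [RHS]integral_mkcond; apply: eq_integral => s _; rewrite patchE.
  case: ifPn => sA.
    rewrite [RHS]integral_mkcond; apply: eq_integral => m _; rewrite /f !patchE.
    by rewrite in_setX/= sA andbT.
  rewrite integral0_eq// => m _; rewrite /f patchE in_setX/= (negbTE sA) andbF//.
by [].
Qed.

(** Turns an inequality valid at every level [m] into one between integrals over [s] of inner
    integrals in [m]: both sides are swapped so that [m] is outermost. *)
Lemma tonelli_le (A B : set R) (P Q : R * R -> R) :
  measurable A -> measurable B -> measurable_fun setT P -> measurable_fun setT Q ->
  (forall z, 0 <= P z) -> (forall z, 0 <= Q z) ->
  (forall m, B m ->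
    (\int[mu]_(s in A) (P (s, m))%:E <= \int[mu]_(s in A) (Q (s, m))%:E)%E) ->
  (\int[mu]_(s in A) \int[mu]_(m in B) (P (s, m))%:E <=
   \int[mu]_(s in A) \int[mu]_(m in B) (Q (s, m))%:E)%E.
Proof.
move=> mA mB mP mQ P0 Q0 PQ; rewrite tonelli_swap// [leRHS]tonelli_swap//.
have mI (S : R * R -> R) : measurable_fun setT S -> (forall z, 0 <= S z) ->
    measurable_fun B (fun m => \int[mu]_(s in A) (S (s, m))%:E)%E.
  move=> mS S0.
  pose f : R * R -> \bar R := (EFin \o S) \_ (A `*` setT).
  have mf : measurable_fun setT f.
    apply/(measurable_restrictT _ _).1; first exact: measurableX.
    by apply: measurable_funTS; exact/measurable_EFinP.
  have f0 z : (0 <= f z)%E.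
    by rewrite /f patchE; case: ifPn => // _; rewrite lee_fin.
  apply: measurable_funTS.
  have := @measurable_fun_fubini_tonelli_G _ _ (measurableTypeR R)
    (measurableTypeR R) R mu f mf f0.
  congr measurable_fun; apply/funext => m; rewrite /fubini_G [RHS]integral_mkcond.
  apply: eq_integral => s _; rewrite /f !patchE in_setX/= in_setT andbT//.
apply: ge0_le_integral => //.
- by move=> m _; apply: integral_ge0 => s _; rewrite lee_fin.
- exact: mI.
- exact: mI.
Qed.

Lemma integral_below (g F : R -> R) (n N w : R) : 0 < n -> n <= N ->
  (forall z : R, 0 < z -> is_derive z 1 F (g z)) ->
  (forall z : R, 0 < z -> {for z, continuous g}) ->
  (\int[mu]_(m in `[n, N]) (if m < w then g m else 0)%:E =
   (if n < w then F (Num.min w N) - F n else 0)%:E)%E.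
Proof.
move=> n0 nN dF cg.
transitivity (\int[mu]_(m in `[n, N] `&` `]-oo, w[) (g m)%:E)%E.
  rewrite integral_mkcondr; apply: eq_integral => m _; rewrite patchE.
  by rewrite (_ : (m \in _) = (m < w)); [case: ifP|apply/idP/idP; rewrite inE/= in_itv].
have [wn|nw] := leP w n.
  rewrite (_ : _ `&` _ = set0) ?integral_set0//; apply/seteqP; split => // m [] /=.
  rewrite !in_itv/= => /andP[nm _] mw; have := lt_le_trans mw wn.
  by rewrite ltNge nm.
have mg (c d : R) : 0 < c -> measurable_fun `[c, d] g.
  move=> c0; apply: subspace_continuous_measurable_fun => //.
  apply: continuous_in_subspaceT => z; rewrite inE/= in_itv/= => /andP[cz _].
  by apply: cg; exact: lt_le_trans cz.
have [wN|Nw] := leP w N.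
  rewrite (_ : _ `&` _ = `[n, w[%classic); last first.
    apply/seteqP; split => [m []|m] /=; rewrite !in_itv/=.
      by move=> /andP[-> _] ->.
    by move=> /andP[-> mw]; rewrite mw (le_trans (ltW mw) wN).
  rewrite integral_itv_bndo_bndc; first exact: (integral_FTC_gt n0 (ltW nw) dF cg).
  apply/measurable_EFinP; apply: measurable_funS (mg n w n0) => //.
  exact: subset_itv_co_cc.
rewrite (_ : _ `&` _ = `[n, N]%classic); last first.
  apply/seteqP; split => [m []|m] /=; rewrite !in_itv/=//.
  by move=> /andP[-> mN]; rewrite mN (le_lt_trans mN Nw).
exact: (integral_FTC_gt n0 nN dF cg).
Qed.
End Tonelli.

(** * From the one-level inequality to higher integrability *)

Section Core.
Context {R : realType}.
Local Notation mu := (@lebesgue_measure R).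
Variables (v : R -> R) (a b p x t : R).
Hypotheses (mv : measurable_fun setT v) (v0 : forall s, 0 <= v s)
  (iv : mu.-integrable `[a, b] (EFin \o v))
  (ivp : mu.-integrable `[a, b] (EFin \o (fun s => v s `^ p)))
  (ab : a < b) (p1 : 1 < p) (pt : p < t) (tx : t < x)
  (D1 : x - p <= ((x - 1) / x) `^ p * x)
  (RHv : forall c d, a <= c -> c < d -> d <= b ->
    (x - p) * \int[mu]_(s in `]c, d]) v s `^ p <=
      x * (((x - 1) / x) * (\int[mu]_(s in `]c, d]) v s / (d - c))) `^ p * (d - c))
  (mean_gt0 : 0 < \int[mu]_(s in `]a, b]) v s).

Let al := (x - 1) / (t - 1).
Let be := x / t.
Let ga := (x - p) / (t - p).
Let K := ga - p * al + (p - 1) * be.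
Let n := ((x - 1) / x) * (\int[mu]_(s in `]a, b]) v s / (b - a)).
Local Notation A := `]a, b]%classic.

Let t0 : 0 < t. Proof. by move: p1 pt => h1 h2; lra. Qed.
Let t1 : 0 < t - 1. Proof. by move: p1 pt => h1 h2; lra. Qed.
Let tp : 0 < t - p. Proof. by rewrite subr_gt0. Qed.
Let xt : 0 < x - t. Proof. by rewrite subr_gt0. Qed.
Let x1 : 0 < x - 1. Proof. by move: p1 pt tx => h1 h2 h3; lra. Qed.
Let x0 : 0 < x. Proof. by move: x1 => h; lra. Qed.
Let px : p < x. Proof. exact: lt_trans tx. Qed.
Let p0 : 0 < p. Proof. by move: p1 => h; lra. Qed.
Let xp_ge0 : 0 <= x - p. Proof. by rewrite subr_ge0 ltW. Qed.
Let p1_ge0 : 0 <= p - 1. Proof. by rewrite subr_ge0 ltW. Qed.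
Let x1_ge0 : 0 <= x - 1. Proof. exact: ltW. Qed.
Let x_ge0 : 0 <= x. Proof. exact: ltW. Qed.
Let p_ge0 : 0 <= p. Proof. exact: ltW. Qed.
Let ba : 0 < b - a. Proof. by rewrite subr_gt0. Qed.
Let n0 : 0 < n. Proof. by rewrite mulr_gt0 ?divr_gt0. Qed.
Let al0 : 0 <= al. Proof. by rewrite divr_ge0// ltW. Qed.
Let be0 : 0 <= be. Proof. by rewrite divr_ge0// ltW. Qed.
Let ga0 : 0 <= ga. Proof. by rewrite divr_ge0// ltW// subr_gt0. Qed.
Let K0 : 0 < K.
Proof.
by rewrite /K trunc_coefE// divr_gt0// !mulr_gt0// subr_gt0.
Qed.

(* [P - Q] is [z.2 `^ (t - p - 1) * kern p x z.2 (v z.1)] where [z.2 < v z.1];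
   the terms are separated by sign so that Tonelli's theorem applies to each. *)
Let P (z : R * R) := if z.2 < v z.1 then
  (x - p) * v z.1 `^ p * z.2 `^ (t - p - 1) + x * (p - 1) * z.2 `^ (t - 1) else 0.
Let Q (z : R * R) := if z.2 < v z.1 then p * (x - 1) * v z.1 * z.2 `^ (t - 1 - 1) else 0.

Let P0 z : 0 <= P z.
Proof.
rewrite /P; case: ifP => // _.
by rewrite !(xp_ge0, p1_ge0, addr_ge0, mulr_ge0, powR_ge0).
Qed.

Let Q0 z : 0 <= Q z.
Proof.
by rewrite /Q; case: ifP => // _; rewrite !(mulr_ge0, powR_ge0).
Qed.

Let mvp : measurable_fun setT (fun s => v s `^ p).
Proof. exact: (measurableT_comp (@measurable_powR R p)). Qed.

Let mlt : measurable_fun setT (fun z : R * R => z.2 < v z.1).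
Proof. by apply: measurable_fun_ltr => //; exact: measurableT_comp. Qed.

Let mP : measurable_fun setT P.
Proof.
apply: measurable_fun_ifT => //; apply: measurable_funD; apply: measurable_funM => //.
- by apply: measurable_funM => //; exact: (measurableT_comp mvp).
- exact: (measurableT_comp (@measurable_powR R (t - p - 1))).
- exact: (measurableT_comp (@measurable_powR R (t - 1))).
Qed.

Let mQ : measurable_fun setT Q.
Proof.
apply: measurable_fun_ifT => //; apply: measurable_funM => //.
- by apply: measurable_funM => //; exact: measurableT_comp.
- exact: (measurableT_comp (@measurable_powR R (t - 1 - 1))).
Qed.

Let ivA : mu.-integrable A (EFin \o v).
Proof. by apply: integrableS iv => // s; rewrite /= !in_itv/= => /andP[/ltW-> ->]. Qed.

Let ivpA : mu.-integrable A (EFin \o (fun s => v s `^ p)).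
Proof. by apply: integrableS ivp => // s; rewrite /= !in_itv/= => /andP[/ltW-> ->]. Qed.

(** For m >= n the mean of [v] is at most mx/(x-1), so [level_integral_le0] applies; P - Q divided
    by m^(t-p-1) is exactly the function integrated there. *)
Let levelPQ m : n <= m ->
  (\int[mu]_(s in A) (P (s, m))%:E <= \int[mu]_(s in A) (Q (s, m))%:E)%E.
Proof.
move=> nm; have m0 : 0 < m by exact: lt_le_trans nm.
have mean_le : \int[mu]_(s in `]a, b]) v s <= m * x / (x - 1) * (b - a).
  rewrite -ler_pdivrMr// ler_pdivlMr// mulrC -ler_pdivrMr//; move: nm; rewrite /n.
  by rewrite mulrAC.
have lev := level_integral_le0 mv v0 iv ivp ab p1 px m0 D1 RHv mean_le.
have iP : mu.-integrable A (fun s => (P (s, m))%:E).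
  apply: (le_integrable _ _ _ (integrableD _
    (integrableZl _ ((x - p) * m `^ (t - p - 1)) ivpA)
    (integrable_cst_itv false false a b (x * (p - 1) * m `^ (t - 1))))) => //.
    by apply: measurable_funTS; apply/measurable_EFinP; exact: (measurableT_comp mP).
  move=> s _; rewrite /= lee_fin ger0_norm// [leRHS]ger0_norm; last first.
    by rewrite !(xp_ge0, p1_ge0, addr_ge0, mulr_ge0, powR_ge0).
  rewrite /P /=; case: ifP => _; first by rewrite mulrAC.
  by rewrite !(xp_ge0, p1_ge0, addr_ge0, mulr_ge0, powR_ge0).
have iQ : mu.-integrable A (fun s => (Q (s, m))%:E).
  apply: (le_integrable _ _ _ (integrableZl _ (p * (x - 1) * m `^ (t - 1 - 1)) ivA)) => //.
    by apply: measurable_funTS; apply/measurable_EFinP; exact: (measurableT_comp mQ).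
  move=> s _; rewrite /= lee_fin ger0_norm// [leRHS]ger0_norm; last first.
    by rewrite !(mulr_ge0, powR_ge0).
  rewrite /Q /=; case: ifP => _; first by rewrite mulrAC.
  by rewrite !(mulr_ge0, powR_ge0).
have iPf : (\int[mu]_(s in A) (P (s, m))%:E)%E \is a fin_num by exact: integrable_fin_num.
have iQf : (\int[mu]_(s in A) (Q (s, m))%:E)%E \is a fin_num by exact: integrable_fin_num.
rewrite -(fineK iPf) -(fineK iQf) lee_fin -subr_le0.
have <- : \int[mu]_(s in A) (P (s, m) - Q (s, m)) =
    fine (\int[mu]_(s in A) (P (s, m))%:E)%E - fine (\int[mu]_(s in A) (Q (s, m))%:E)%E.
  by rewrite RintegralB.
have c0 : 0 < (m `^ (t - p - 1))^-1 by rewrite invr_gt0 powR_gt0.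
rewrite -(pmulr_rle0 _ c0) -RintegralZl//; last exact: (integrableB _ iP iQ).
apply: le_trans lev; rewrite le_eqVlt; apply/orP; left; apply/eqP.
apply: eq_Rintegral => s _; rewrite /P /Q /=; case: ifP => _; last by rewrite subrr mulr0.
have E2 : m `^ (t - 1 - 1) = m `^ (t - p - 1) * m `^ (p - 1).
  by rewrite -powRD_gt0//; congr powR; ring.
have E3 : m `^ (t - 1) = m `^ (t - p - 1) * m `^ p.
  by rewrite -powRD_gt0//; congr powR; ring.
rewrite E2 E3 /kern; field.
by rewrite gt_eqF// powR_gt0.
Qed.

(** [F] and [G] are antiderivatives in [m] of the nonzero branches of [P] and [Q]. The truncated
    power [T] is dominated by a multiple of v^p, hence integrable before v^t is known to be. *)
Let F w m := ga * (w `^ p * m `^ (t - p)) + (p - 1) * be * m `^ t.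
Let G w m := p * al * (w * m `^ (t - 1)).
Let T N s := v s `^ p * Num.min (v s) N `^ (t - p).

Let F0 w m : 0 <= F w m.
Proof. by rewrite /F !(p1_ge0, ga0, be0, addr_ge0, mulr_ge0, powR_ge0). Qed.

Let G0 w m : 0 <= w -> 0 <= G w m.
Proof. by move=> w0; rewrite /G !(p_ge0, al0, w0, mulr_ge0, powR_ge0). Qed.

Let T0 N s : 0 <= T N s.
Proof. by rewrite /T mulr_ge0 ?powR_ge0. Qed.

(** The values at [n] telescope when v s > n. What remains is [kern_primitive_le] at level [n] if v
    s <= n, at level [v s] if n < v s <= N, and [trunc_tangent] above [N]. *)
Let T_le N s : n <= N ->
  K * T N s + (if n < v s then G (v s) (Num.min (v s) N) - G (v s) n else 0)
    + G (v s) n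
  <= (if n < v s then F (v s) (Num.min (v s) N) - F (v s) n else 0) + F (v s) n.
Proof.
move=> nN; have [vn|nv] := leP (v s) n.
  rewrite add0r addr0 /T min_l ?(le_trans vn)//.
  have -> : v s `^ p * v s `^ (t - p) = v s `^ t.
    have := v0 s; rewrite le_eqVlt => /predU1P[<-|vs0].
      by rewrite !powR0 ?mul0r ?gt_eqF.
    by rewrite mulrC powR_mul_split.
  exact: (kern_primitive_le p1 pt tx (v0 s) vn n0).
rewrite -addrA !subrK /T.
have [vN|Nv] := leP (v s) N.
  have vs0 : 0 < v s by exact: lt_trans nv.
  have -> : v s `^ p * v s `^ (t - p) = v s `^ t by rewrite mulrC powR_mul_split.
  exact: (kern_primitive_le p1 pt tx (v0 s) (lexx _) vs0).
exact: (trunc_tangent p1 pt tx (lt_le_trans n0 nN) (ltW Nv)).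
Qed.

Let int_P1 N s : n <= N -> (\int[mu]_(m in `[n, N]) (P (s, m))%:E =
  (if n < v s then F (v s) (Num.min (v s) N) - F (v s) n else 0)%:E)%E.
Proof.
move=> nN.
apply: (@integral_below _ (fun m => (x - p) * v s `^ p * m `^ (t - p - 1)
  + x * (p - 1) * m `^ (t - 1)) (F (v s)) n N (v s) n0 nN).
- move=> z z0; have h1 := is_derive_powR (t - p) z0.
  have h2 := is_derive_powR t z0.
  have -> : (x - p) * v s `^ p * z `^ (t - p - 1) + x * (p - 1) * z `^ (t - 1) =
      ga * (v s `^ p * ((t - p) * z `^ (t - p - 1))) + (p - 1) * be * (t * z `^ (t - 1)).
    by rewrite /ga /be; field; rewrite !gt_eqF.
  exact: is_deriveD.
- move=> z z0; apply: continuousD; apply: continuousM => //;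
    by [exact: cvg_cst | exact: continuous_powR_gt0].
Qed.

Let int_Q1 N s : n <= N -> (\int[mu]_(m in `[n, N]) (Q (s, m))%:E =
  (if n < v s then G (v s) (Num.min (v s) N) - G (v s) n else 0)%:E)%E.
Proof.
move=> nN.
apply: (@integral_below _ (fun m => p * (x - 1) * v s * m `^ (t - 1 - 1))
  (G (v s)) n N (v s) n0 nN).
- move=> z z0; have h1 := is_derive_powR (t - 1) z0.
  have -> : p * (x - 1) * v s * z `^ (t - 1 - 1) =
      p * al * (v s * ((t - 1) * z `^ (t - 1 - 1))).
    by rewrite /al; field; rewrite !gt_eqF.
  by apply: is_deriveZ.
- move=> z z0; apply: continuousM => //;
    by [exact: cvg_cst | exact: continuous_powR_gt0].
Qed.

Let mmin N : measurable_fun setT (fun s => Num.min (v s) N).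
Proof. exact: measurable_minr. Qed.

Let mT N : measurable_fun setT (T N).
Proof.
apply: measurable_funM => //.
exact: (measurableT_comp (@measurable_powR R (t - p)) (mmin N)).
Qed.

Let mF m : measurable_fun setT (fun s => F (v s) m).
Proof.
by apply: measurable_funD => //; apply: measurable_funM => //; apply: measurable_funM.
Qed.

Let mG m : measurable_fun setT (fun s => G (v s) m).
Proof. by apply: measurable_funM => //; apply: measurable_funM. Qed.

Let iF m : mu.-integrable A (EFin \o (fun s => F (v s) m)).
Proof.
apply: (eq_integrable _ _ _ _ (integrableD _
  (integrableZl _ (ga * m `^ (t - p)) ivpA)
  (integrable_cst_itv false false a b ((p - 1) * be * m `^ t)))) => //.
by move=> s _; congr EFin; rewrite /= /F; ring.
Qed.

Let iG m : mu.-integrable A (EFin \o (fun s => G (v s) m)).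
Proof.
apply: (eq_integrable _ _ _ _ (integrableZl _ (p * al * m `^ (t - 1)) ivA)) => //.
by move=> s _; congr EFin; rewrite /= /G; ring.
Qed.

Let min_powR N r s : n <= N -> 0 <= r -> Num.min (v s) N `^ r <= N `^ r.
Proof.
move=> nN r0; have N0 : 0 <= N by rewrite (le_trans (ltW n0)).
have m0 : 0 <= Num.min (v s) N by rewrite le_min v0.
have mN : Num.min (v s) N <= N by rewrite ge_min lexx orbT.
by apply: ge0_ler_powR; rewrite ?nnegrE.
Qed.

Let iT N : n <= N -> mu.-integrable A (EFin \o T N).
Proof.
move=> nN; apply: (le_integrable _ _ _ (integrableZl _ (N `^ (t - p)) ivpA)) => //.
  by apply: measurable_funTS; apply/measurable_EFinP; exact: mT.
move=> s _ /=; rewrite lee_fin !ger0_norm ?mulr_ge0 ?powR_ge0//.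
by rewrite /T [leRHS]mulrC ler_wpM2l ?powR_ge0// min_powR// ltW.
Qed.

Let P1 N s := if n < v s then F (v s) (Num.min (v s) N) - F (v s) n else 0.
Let Q1 N s := if n < v s then G (v s) (Num.min (v s) N) - G (v s) n else 0.

Let P1_ge0 N s : n <= N -> 0 <= P1 N s.
Proof. by move=> nN; rewrite -lee_fin -int_P1//; apply: integral_ge0 => m _; exact: P0. Qed.

Let Q1_ge0 N s : n <= N -> 0 <= Q1 N s.
Proof. by move=> nN; rewrite -lee_fin -int_Q1//; apply: integral_ge0 => m _; exact: Q0. Qed.

Let mnv : measurable_fun setT (fun s => n < v s).
Proof. exact: measurable_fun_ltr. Qed.

Let mminr N r : measurable_fun setT (fun s => Num.min (v s) N `^ r).
Proof. exact: (measurableT_comp (@measurable_powR R r) (mmin N)). Qed.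

Let iP1 N : n <= N -> mu.-integrable A (EFin \o P1 N).
Proof.
move=> nN; apply: (le_integrable _ _ _ (iF N)) => //.
  apply: measurable_funTS; apply/measurable_EFinP; apply: measurable_fun_ifT => //.
  apply: measurable_funB; last exact: mF.
  apply: measurable_funD; apply: measurable_funM => //; last exact: mminr.
  by apply: measurable_funM => //; exact: mminr.
move=> s _ /=; rewrite lee_fin !ger0_norm ?P1_ge0//.
rewrite /P1; case: ifP => // _; rewrite (le_trans (_ : _ <= F (v s) (Num.min (v s) N)))//.
  by rewrite lerBlDr lerDl.
rewrite /F lerD//.
  by rewrite ler_wpM2l// ler_wpM2l ?powR_ge0// min_powR// ltW.
by apply: ler_wpM2l; [rewrite mulr_ge0|apply: min_powR => //; exact: ltW].
Qed.

Let iQ1 N : n <= N -> mu.-integrable A (EFin \o Q1 N).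
Proof.
move=> nN; apply: (le_integrable _ _ _ (iG N)) => //.
  apply: measurable_funTS; apply/measurable_EFinP; apply: measurable_fun_ifT => //.
  apply: measurable_funB; last exact: mG.
  by apply: measurable_funM => //; apply: measurable_funM => //; exact: mminr.
move=> s _ /=; rewrite lee_fin !ger0_norm ?Q1_ge0 ?G0//.
rewrite /Q1; case: ifP => // _; last exact: G0.
rewrite (le_trans (_ : _ <= G (v s) (Num.min (v s) N)))//.
  by rewrite lerBlDr lerDl G0.
apply: ler_wpM2l; first by rewrite mulr_ge0.
by apply: ler_wpM2l => //; apply: min_powR => //; exact: ltW.
Qed.

Let P1_le_Q1 N : n <= N -> \int[mu]_(s in A) P1 N s <= \int[mu]_(s in A) Q1 N s.
Proof.
move=> nN; have iP := iP1 nN; have iQ := iQ1 nN.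
have fP : (\int[mu]_(s in A) (P1 N s)%:E)%E \is a fin_num by exact: integrable_fin_num.
have fQ : (\int[mu]_(s in A) (Q1 N s)%:E)%E \is a fin_num by exact: integrable_fin_num.
suff h : (\int[mu]_(s in A) (P1 N s)%:E <= \int[mu]_(s in A) (Q1 N s)%:E)%E.
  exact: (@fine_le R _ _ fP fQ h).
under eq_integral do rewrite -int_P1//.
under [leRHS]eq_integral do rewrite -int_Q1//.
apply: tonelli_le => // m; rewrite /= in_itv/= => /andP[nm _].
exact: levelPQ.
Qed.

(** Integrate [T_le]. The [P1] and [Q1] integrals are finite and compare by [P1_le_Q1], which leaves
    boundary terms at level [n]: there the integral of [v] is a multiple of [n] by definition and
    that of v^p is bounded by [RHv] on the whole interval. *)
Let trunc_bound N : n <= N ->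
  (\int[mu]_(s in A) (T N s)%:E <= (x / (x - t) * n `^ t * (b - a))%:E)%E.
Proof.
move=> nN.
have iTf : (\int[mu]_(s in A) (T N s)%:E)%E \is a fin_num.
  by apply: integrable_fin_num => //; exact: iT.
rewrite -(fineK iTf) lee_fin -/(Rintegral mu A (T N)).
have iKT : mu.-integrable A (EFin \o (fun s => K * T N s)).
  exact: (integrableZl _ K (iT nN)).
have H1 : \int[mu]_(s in A) (K * T N s + Q1 N s + G (v s) n) <=
  \int[mu]_(s in A) (P1 N s + F (v s) n).
  apply: le_Rintegral => //.
  - exact: (integrableD _ (integrableD _ iKT (iQ1 nN)) (iG n)).
  - exact: (integrableD _ (iP1 nN) (iF n)).
  - by move=> s _; exact: T_le.
rewrite (RintegralD _ (integrableD _ iKT (iQ1 nN)) (iG n))// in H1.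
rewrite (RintegralD _ iKT (iQ1 nN))// in H1.
rewrite (RintegralD _ (iP1 nN) (iF n))// in H1.
rewrite (RintegralZl _ _ (iT nN))// in H1.
have H2 := P1_le_Q1 nN.
have EG : \int[mu]_(s in A) G (v s) n = p * al * n `^ (t - 1) * \int[mu]_(s in A) v s.
  rewrite -RintegralZl//; apply: eq_Rintegral => s _.
  by rewrite /G; ring.
have EF : \int[mu]_(s in A) F (v s) n =
    ga * n `^ (t - p) * \int[mu]_(s in A) v s `^ p + (p - 1) * be * n `^ t * (b - a).
  rewrite RintegralD//; last 2 first.
  - apply: (eq_integrable _ _ _ _ (integrableZl _ (ga * n `^ (t - p)) ivpA)) => //.
    by move=> s _; congr EFin; rewrite /=; ring.
  - exact: integrable_cst_itv.
  rewrite Rintegral_cst// fine_lebesgue_itv_oc ?(ltW ab)//; congr (_ + _).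
  rewrite -RintegralZl//; apply: eq_Rintegral => s _.
  by ring.
have Ev : \int[mu]_(s in A) v s = n * x / (x - 1) * (b - a).
  by rewrite /n; field; rewrite !gt_eqF.
have := RHv (lexx a) ab (lexx b); rewrite -/n => Hp.
have {}Hp : ga * n `^ (t - p) * \int[mu]_(s in A) v s `^ p <=
    x / (t - p) * n `^ t * (b - a).
  have h : 0 <= n `^ (t - p) / (t - p) by rewrite divr_ge0 ?powR_ge0// ltW.
  have := ler_wpM2l h Hp; rewrite -(powR_mul_split t p n0) /ga.
  set I := \int[_]_(_ in _) _; congr (_ <= _); field; rewrite gt_eqF//.
rewrite EF EG Ev in H1.
have : K * \int[mu]_(s in A) T N s <= K * (x / (x - t) * n `^ t * (b - a)); last first.
  by rewrite ler_pM2l.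
(* All boundary terms are multiples of n^t (b-a); this collects their coefficients. *)
have EK : K * (x / (x - t)) = x / (t - p) + (p - 1) * be - p * x / (t - 1).
  by rewrite /K trunc_coefE// /be; field; rewrite !gt_eqF.
have -> : K * (x / (x - t) * n `^ t * (b - a)) =
    (x / (t - p) + (p - 1) * be - p * x / (t - 1)) * n `^ t * (b - a).
  by rewrite -EK; ring.
have EG' : p * al * n `^ (t - 1) * (n * x / (x - 1) * (b - a)) =
    p * x / (t - 1) * n `^ t * (b - a).
  by rewrite -(@mulr_powRB1 _ n t) ?(ltW n0)// /al; field; rewrite !gt_eqF.
rewrite EG' in H1.
move: H1 H2 Hp; set I1 := \int[_]_(_ in _) _; set I2 := \int[_]_(_ in _) _.
set I3 := \int[_]_(_ in _) _; set I4 := \int[_]_(_ in _) _.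
set n' := n `^ t; set w := _ * I4.
by move: I1 I2 I3 w n' => I1 I2 I3 w n' h1 h2 h3; lra.
Qed.

(** Monotone convergence in the truncation level n + k, which starts at [n] so that [trunc_bound]
    applies; at each point the truncation is eventually inactive. *)
Lemma higher_integrability :
  (\int[mu]_(s in `]a, b]) (v s `^ t)%:E <=
    (x / (x - t) * ((x - 1) / x * (\int[mu]_(s in `]a, b]) v s / (b - a))) `^ t
      * (b - a))%:E)%E.
Proof.
pose g (k : nat) s := (T (n + k%:R) s)%:E.
have nk (k : nat) : n <= n + k%:R by rewrite lerDl.
have cvT s : g k s @[k --> \oo] --> (v s `^ t)%:E.
  apply: cvg_near_cst; near=> k; rewrite /g /T min_l; last first.
    rewrite (@le_trans _ _ k%:R)//; first by near: k; exact: nbhs_infty_ger.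
    by rewrite lerDr ltW.
  congr EFin; have := v0 s; rewrite le_eqVlt => /predU1P[<-|vs0].
    by rewrite !powR0 ?mul0r ?gt_eqF.
  by rewrite mulrC powR_mul_split.
have mg k : measurable_fun A (g k).
  by apply: measurable_funTS; apply/measurable_EFinP; exact: mT.
have g0 k s : A s -> (0 <= g k s)%E by move=> _; rewrite lee_fin.
have nd_g s : A s -> {homo g ^~ s : k l / (k <= l)%N >-> (k <= l)%E}.
  move=> _ k l kl; rewrite lee_fin /T ler_wpM2l ?powR_ge0//.
  have m0 (N : R) : n <= N -> 0 <= Num.min (v s) N.
    by move=> nN; rewrite le_min v0 (le_trans (ltW n0)).
  apply: ge0_ler_powR; rewrite ?nnegrE ?m0 ?(ltW tp)//.
  by rewrite le_min2// lerD2l ler_nat.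
have := @cvg_monotone_convergence _ _ _ mu A (measurable_itv _) g mg g0 nd_g.
have -> : (\int[mu]_(s in A) limn (g ^~ s) = \int[mu]_(s in A) (v s `^ t)%:E)%E.
  by apply: eq_integral => s _; apply/cvg_lim.
by move/cvge_to_le; apply; apply: nearW => k; exact: (trunc_bound (nk k)).
Unshelve. all: by end_near. Qed.
End Core.

(** * Means over subintervals *)

Section Means.
Context {R : realType}.
Local Notation cmu := (@completed_lebesgue_measure R).
Local Notation mu := (@lebesgue_measure R).
Local Notation LT := (lebesgue_measurableTypeR R).

Lemma bounded_interval_itv (J : set R) : bounded_interval J ->
  exists a b b1 b2, a < b /\ J = [set` Interval (BSide b1 a) (BSide b2 b)].
Proof.
move=> [iJ [M [_ bJ]] [x [y [Jx Jy xy]]]].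
have M1 : M < M + 1 by rewrite ltrDl.
have lJ : has_lbound J.
  exists (- (M + 1)) => z Jz; have /= := bJ (M + 1) M1 z Jz.
  by rewrite ler_norml => /andP[].
have uJ : has_ubound J.
  exists (M + 1) => z Jz; have /= := bJ (M + 1) M1 z Jz.
  by rewrite ler_norml => /andP[].
have := (is_intervalP J).1 iJ; rewrite /Rhull (asboolT lJ) (asboolT uJ) => JE.
exists (inf J), (sup J), `[<J (inf J)>], (~~ `[<J (sup J)>]); split => //.
apply: le_lt_trans (ge_inf lJ Jx) _; apply: lt_le_trans xy _; exact: ub_le_sup.
Qed.

(** Open intervals stay inside [I] whichever of its end points belong to it, so the class condition
    can be applied to them freely. *)
Lemma subinterval_oo (I : set R) a b b1 b2 c d :
  I = [set` Interval (BSide b1 a) (BSide b2 b)] -> a <= c -> c < d -> d <= b ->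
  subinterval I `]c, d[.
Proof.
move=> -> ac cd db; split; last first.
  move=> z /=; rewrite !in_itv/= => /andP[cz zd].
  by rewrite (lteifS _ (le_lt_trans ac cz)) (lteifS _ (lt_le_trans zd db)).
split; first exact: interval_is_interval.
- exists (`|c| + `|d|); split; first exact: num_real.
  move=> M hM z /=; rewrite in_itv/= => /andP[cz zd]; rewrite (le_trans _ (ltW hM))//.
  rewrite ler_norml; have := ler_norm d; have := ler_norm (- c).
  have := normr_ge0 c; have := normr_ge0 d.
  by rewrite normrN => h1 h2 h3 h4; apply/andP; split; lra.
- exists ((2 * c + d) / 3), ((c + 2 * d) / 3); rewrite /= !in_itv/=.
  by split; [apply/andP; split; lra|apply/andP; split; lra|lra].
Qed.

(** [A] is extended-real so that divergent power integrals are covered: for an infinite [A] both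
    sides are false. *)
Lemma power_mean_ratio_leP (A : \bar R) (B C r : R) :
  0 < r -> 0 < B -> 0 <= C -> (0 <= A)%E ->
  (A `^ r^-1 / B%:E <= C%:E)%E <-> (A <= ((C * B) `^ r)%:E)%E.
Proof.
move=> r0 B0 C0 A0; have ri0 : 0 < r^-1 by rewrite invr_gt0.
have rn0 : r != 0 by rewrite gt_eqF.
rewrite inver gt_eqF// lee_pdivrMr//.
case: A A0 => [a a0|_|//]; last first.
  have -> : (+oo `^ r^-1 = +oo :> \bar R)%E by rewrite poweRyr// invr_eq0.
  by rewrite -EFinM.
rewrite lee_fin in a0; rewrite poweR_EFin -EFinM !lee_fin; split => h.
- rewrite -[a](@powRr1 _ a)// -(mulVf rn0) powRrM.
  by apply: ge0_ler_powR; rewrite ?nnegrE ?powR_ge0 ?mulr_ge0// ltW.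
- rewrite -[C * B](@powRr1 _ (C * B)) ?mulr_ge0 ?(ltW B0)//.
  rewrite -(mulfV rn0) powRrM.
  by apply: ge0_ler_powR; rewrite ?nnegrE ?powR_ge0// ltW.
Qed.

(** End points are null, so every interval is normalised to the half-open form, which concatenates
    without overlap. *)
Lemma mean_borel (f : R -> R) b1 b2 c d : measurable_fun setT f ->
  (forall s, 0 <= f s) -> c < d ->
  mean f [set` Interval (BSide b1 c) (BSide b2 d)] =
  (\int[mu]_(s in `]c, d]) (f s)%:E * ((d - c)^-1)%:E)%E.
Proof.
move=> mf f0 cd; rewrite /mean; set J := [set` _].
have mJ : measurable J by exact: measurable_itv.
have mfE : measurable_fun setT (EFin \o f) by exact/measurable_EFinP.
have -> : completed_lebesgue_measure J = (d - c)%:E.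
  by rewrite [LHS](lebesgue_measure_itv (Interval (BSide b1 c) (BSide b2 d)))/= lte_fin cd.
rewrite inver gt_eqF ?subr_gt0//; congr (_ * _)%E.
rewrite integral_completed_lebesgue//.
- rewrite (integral_itv_bndoo b1 b2); last exact: measurable_funTS.
  by rewrite [RHS](integral_itv_bndoo false false)//; exact: measurable_funTS.
- exact: measurable_funTS.
- by move=> s _; rewrite lee_fin.
Qed.

(** One [v] serves every [phi], because the exceptional null set depends on [w] alone; it is used
    with the identity and with powers. *)
Lemma weight_borel (I : set R) (w : R -> R) : measurable I -> weight I w ->
  exists v : R -> R, [/\ measurable_fun setT v, forall s, 0 <= v s &
    forall (phi : R -> R) b1 b2 c d, measurable_fun setT phi ->
      (forall z, 0 <= z -> 0 <= phi z) -> c < d ->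
      [set` Interval (BSide b1 c) (BSide b2 d)] `<=` I ->
      mean (fun s => phi (w s)) [set` Interval (BSide b1 c) (BSide b2 d)] =
      (\int[mu]_(s in `]c, d]) (phi (v s))%:E * ((d - c)^-1)%:E)%E].
Proof.
move=> mI [mw w0].
have [v [mv v0 [N [mN N0 vw]]]] := lebesgue_measurable_borel_fun mI mw w0.
exists v; split => // phi b1 b2 c d mphi phi0 cd JI; set J := [set` _] in JI *.
have mJ : measurable J by exact: measurable_itv.
have mphiv : measurable_fun setT (phi \o v) by exact: measurableT_comp.
rewrite -(mean_borel b1 b2 mphiv)//; last by move=> s; exact: phi0.
rewrite /mean -/J; congr (_ / _)%E; apply: ge0_ae_eq_integral.
- exact: borel_lebesgue.
- apply/measurable_EFinP; apply: measurableT_comp => //.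
  by apply: measurable_funS mw => //; exact: borel_lebesgue.
- apply: measurable_fun_lebesgue => //; apply: measurable_funTS.
  exact/measurable_EFinP.
- by move=> s /JI/w0/phi0; rewrite lee_fin.
- by move=> s _; rewrite lee_fin phi0.
- exists N; split => //; first exact: borel_lebesgue.
  move=> s /= /not_implyP[Js] ne; apply: contrapT => nN; apply: ne.
  by rewrite vw//; exact: JI.
Qed.
End Means.

(** * The upper bound for weights in the class *)

Section Upper.
Context {R : realType}.
Local Notation mu := (@lebesgue_measure R).

Lemma integrable_itv_cc (v : R -> R) (a b : R) : measurable_fun setT v ->
  (forall s, 0 <= v s) -> (\int[mu]_(s in `]a, b]) (v s)%:E < +oo)%E ->
  mu.-integrable `[a, b] (EFin \o v).
Proof.
move=> mv v0 vy; apply/integrableP; split.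
  by apply: measurable_funTS; exact/measurable_EFinP.
rewrite (integral_itv_bndoo true false); last first.
  by apply: measurable_funTS; apply: measurableT_comp => //; exact/measurable_EFinP.
rewrite -(integral_itv_bndoo false false); last first.
  by apply: measurable_funTS; apply: measurableT_comp => //; exact/measurable_EFinP.
by under eq_integral do rewrite /= ger0_norm//.
Qed.

(** [x] and [delta] are tied by an inequality, so as to cover both the critical exponent, where
    equality holds, and delta = 1, where every x > t qualifies. *)
Lemma RH_power_mean_ratio_le (I J : set R) (w : R -> R) (p delta x t : R) :
  1 < p -> p < t -> t < x -> 1 <= delta ->
  (x - p) * delta `^ p <= x * ((x - 1) / x) `^ p ->
  bounded_interval I -> RH p delta I w -> subinterval I J ->
  (power_mean_ratio t w J <= ((x - 1) / x * (x / (x - t)) `^ t^-1)%:E)%E.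
Proof.
move=> p1 pt tx d1 Dx bI [wI hRH] sJ.
have [_ JI] := sJ; have [a [b [b1 [b2 [ab JE]]]]] := bounded_interval_itv sJ.1.
have mI : measurable I by apply: is_interval_measurable; case: bI.
have [v [mv v0 mean_v]] := weight_borel mI wI.
have t0 : 0 < t by lra.
have p0 : 0 < p by lra.
have x0 : 0 < x by lra.
have x1 : 0 < x - 1 by lra.
have xt : 0 < x - t by lra.
have xp : 0 < x - p by lra.
have delta0 : 0 <= delta by lra.
have Ev b3 b4 c d : c < d -> [set` Interval (BSide b3 c) (BSide b4 d)] `<=` I ->
    mean w [set` Interval (BSide b3 c) (BSide b4 d)] =
    (\int[mu]_(s in `]c, d]) (v s)%:E * ((d - c)^-1)%:E)%E.
  by move=> cd cI; apply: (mean_v (fun z => z)).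
have Evr r b3 b4 c d : c < d -> [set` Interval (BSide b3 c) (BSide b4 d)] `<=` I ->
    mean (fun s => w s `^ r) [set` Interval (BSide b3 c) (BSide b4 d)] =
    (\int[mu]_(s in `]c, d]) (v s `^ r)%:E * ((d - c)^-1)%:E)%E.
  move=> cd cI; apply: (mean_v (fun z => z `^ r)) => //.
  by move=> z _; exact: powR_ge0.
have fin c d : a <= c -> c < d -> d <= b ->
    [/\ (\int[mu]_(s in `]c, d]) (v s)%:E < +oo)%E, 0 < \int[mu]_(s in `]c, d]) v s &
     (\int[mu]_(s in `]c, d]) (v s `^ p)%:E <=
       ((delta * (\int[mu]_(s in `]c, d]) v s / (d - c))) `^ p * (d - c))%:E)%E].
  move=> ac cd db; have dc : 0 < d - c by rewrite subr_gt0.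
  have [bcd cdJ] := subinterval_oo JE ac cd db.
  have cdI : `]c, d[%classic `<=` I by exact: subset_trans JI.
  have [/andP[m0 my]] := hRH _ (conj bcd cdI).
  rewrite Ev// in m0 my *.
  have vy : (\int[mu]_(s in `]c, d]) (v s)%:E < +oo)%E.
    rewrite ltey; apply: contraTneq my => ->.
    by rewrite gt0_mulye ?lte_fin ?invr_gt0.
  have vf : (\int[mu]_(s in `]c, d]) (v s)%:E)%E \is a fin_num.
    by rewrite ge0_fin_numE// integral_ge0// => s _; rewrite lee_fin.
  rewrite /power_mean_ratio Evr// Ev//.
  move: m0; rewrite -(fineK vf) -EFinM lte_fin -/(Rintegral mu _ _) => m0 H.
  split; first by rewrite ltry.
    by move: m0; rewrite pmulr_lgt0 ?invr_gt0.
  have {}H := (power_mean_ratio_leP p0 m0 delta0 _).1 H.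
  rewrite lee_pdivrMr// -EFinM in H; apply: H.
  apply: mule_ge0; last by rewrite lee_fin invr_ge0 ltW.
  by apply: integral_ge0 => s _; rewrite lee_fin powR_ge0.
have [vy vpos vp] := fin a b (lexx _) ab (lexx _).
have ba : 0 < b - a by rewrite subr_gt0.
have mvp : measurable_fun setT (fun s => v s `^ p).
  exact: (measurableT_comp (@measurable_powR R p)).
have iv := integrable_itv_cc mv v0 vy.
have ivp := integrable_itv_cc mvp (fun s => powR_ge0 _ _) (le_lt_trans vp (ltry _)).
(* As delta >= 1, its power may be dropped; this is the sign condition on [kern] at its right
   end. *)
have D1 : x - p <= ((x - 1) / x) `^ p * x.
  rewrite mulrC; apply: le_trans Dx; rewrite ler_peMr ?(ltW xp)//.
  have : 1 `^ p <= delta `^ p by apply: ge0_ler_powR; rewrite ?nnegrE// ltW.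
  by rewrite powR1.
have RHv c d : a <= c -> c < d -> d <= b ->
    (x - p) * \int[mu]_(s in `]c, d]) v s `^ p <=
      x * (((x - 1) / x) * (\int[mu]_(s in `]c, d]) v s / (d - c))) `^ p * (d - c).
  move=> ac cd db; have [_ vcd vpcd] := fin c d ac cd db.
  have dc : 0 < d - c by rewrite subr_gt0.
  have vpf : (\int[mu]_(s in `]c, d]) (v s `^ p)%:E)%E \is a fin_num.
    rewrite ge0_fin_numE ?(le_lt_trans vpcd) ?ltry//.
    by apply: integral_ge0 => s _; rewrite lee_fin powR_ge0.
  rewrite -(fineK vpf) lee_fin -/(Rintegral mu _ _) in vpcd.
  have m0 : 0 <= \int[mu]_(s in `]c, d]) v s / (d - c) by rewrite divr_ge0// ltW.
  apply: le_trans (ler_wpM2l (ltW xp) vpcd) _.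
  have k0 : 0 <= (x - 1) / x by rewrite divr_ge0// ltW.
  rewrite (powRM _ delta0 m0) (powRM _ k0 m0) !mulrA.
  by do 2 (apply: ler_wpM2r; rewrite ?powR_ge0 ?(ltW dc)//).
have := higher_integrability mv v0 iv ivp ab p1 pt tx D1 RHv vpos.
rewrite JE in JI *; rewrite /power_mean_ratio Ev// Evr//.
have vf : (\int[mu]_(s in `]a, b]) (v s)%:E)%E \is a fin_num.
  by rewrite ge0_fin_numE// integral_ge0// => s _; rewrite lee_fin.
rewrite -(fineK vf) -EFinM -/(Rintegral mu _ _) => H.
apply/power_mean_ratio_leP => //.
- by rewrite divr_gt0.
- by rewrite mulr_ge0 ?powR_ge0// divr_ge0// ltW.
- apply: mule_ge0; last by rewrite lee_fin invr_ge0 ltW.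
  by apply: integral_ge0 => s _; rewrite lee_fin powR_ge0.
rewrite lee_pdivrMr// -EFinM; apply: le_trans H _; rewrite lee_fin.
have B0 : 0 <= \int[mu]_(s in `]a, b]) v s / (b - a) by rewrite divr_ge0// ltW.
have k0 : 0 <= (x - 1) / x by rewrite divr_ge0// ltW.
have X0 : 0 <= x / (x - t) by rewrite divr_ge0// ltW.
rewrite (powRM _ (mulr_ge0 k0 (powR_ge0 _ _)) B0) (powRM _ k0 (powR_ge0 _ _)).
rewrite (powRM _ k0 B0) -powRrM mulVf ?gt_eqF// powRr1//.
by rewrite le_eqVlt; apply/orP; left; apply/eqP; ring.
Qed.
End Upper.

(** * Extremal power weights *)

Section Power.
Context {R : realType}.
Local Notation mu := (@lebesgue_measure R).

Lemma measurable_shift_powR (a r : R) : measurable_fun setT (fun s : R => (s - a) `^ r).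
Proof.
apply: (measurableT_comp (@measurable_powR R r)).
by apply: measurable_funB.
Qed.

Lemma is_derive_shift_powR (a r z : R) : a < z ->
  is_derive z 1 (fun s : R => (s - a) `^ r) (r * (z - a) `^ (r - 1)).
Proof.
move=> az; have h : is_derive (z - a) 1 (fun s : R => s `^ r) (r * (z - a) `^ (r - 1)).
  by apply: is_derive_powR; rewrite subr_gt0.
have hs : is_derive z 1 (fun s : R => s - a) 1.
  rewrite -[X in is_derive _ _ _ X]subr0.
  exact: (is_deriveB (is_derive_id z 1) (is_derive_cst a z 1)).
by have := @is_derive1_comp R (fun s => s `^ r) (fun s => s - a) z _ _ h hs; rewrite mulr1.
Qed.

Lemma integral_shift_powR_lt (a q c d : R) : q != 0 -> a < c -> c <= d ->
  (\int[mu]_(s in `[c, d]) ((s - a) `^ (q - 1))%:E =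
   (((d - a) `^ q - (c - a) `^ q) / q)%:E)%E.
Proof.
move=> q0 ac cd; rewrite mulrC mulrBr.
apply: (@integral_FTC_gt R _ (fun s => q^-1 * (s - a) `^ q) a) => //.
- move=> z az; have h := is_derive_shift_powR q az.
  have -> : (z - a) `^ (q - 1) = q^-1 * (q * (z - a) `^ (q - 1)).
    by rewrite mulrA mulVf// mul1r.
  exact: is_deriveZ.
- move=> z az; apply: differentiable_continuous; apply/derivable1_diffP.
  by have [] := is_derive_shift_powR (q - 1) az.
Qed.

(** For c = a the integrand may be singular at [a]: the interval is exhausted by [a + u n, d] with u
    n = (d-a)/(n+1), and (u n)^q tends to 0 because q > 0. *)
Lemma integral_shift_powR (a q c d : R) : 0 < q -> a <= c -> c < d ->
  (\int[mu]_(s in `]c, d]) ((s - a) `^ (q - 1))%:E =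
   (((d - a) `^ q - (c - a) `^ q) / q)%:E)%E.
Proof.
move=> q0; have qn0 : q != 0 by rewrite gt_eqF.
have mf D : measurable_fun D (fun s : R => ((s - a) `^ (q - 1))%:E).
  by apply: measurable_funTS; apply/measurable_EFinP; exact: measurable_shift_powR.
rewrite le_eqVlt => /predU1P[<-|ac] cd; last first.
  by rewrite integral_itv_obnd_cbnd//; apply: integral_shift_powR_lt => //; exact: ltW.
have da : 0 < d - a by rewrite subr_gt0.
pose u (n : nat) : R := (d - a) * n.+1%:R^-1.
have u0 n : 0 < u n by rewrite mulr_gt0// invr_gt0.
have ud n : a + u n <= d.
  by rewrite -lerBrDl /u ler_piMr ?(ltW da)// invf_le1 ?ler1n.
pose S n : set R := `[a + u n, d]%classic.
have SE : \bigcup_n S n = `]a, d]%classic.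
  apply/seteqP; split => [z [n _]|z]; rewrite /S /= !in_itv/=.
    by move=> /andP[az ->]; rewrite andbT (lt_le_trans _ az)// ltrDl.
  move=> /andP[az zd].
  have za : 0 < (z - a) / (d - a) by rewrite divr_gt0// subr_gt0.
  have [n _ hn] := near_infty_natSinv_lt (PosNum za).
  exists n => //; rewrite /S /= in_itv/= zd andbT -lerBrDl /u.
  by rewrite mulrC -ler_pdivlMr// ltW//; exact: (hn n (leqnn n)).
have cvS : (\int[mu]_(s in S n) ((s - a) `^ (q - 1))%:E)%E @[n --> \oo] -->
    (\int[mu]_(s in `]a, d]) ((s - a) `^ (q - 1))%:E)%E.
  rewrite -SE; apply: ge0_nondecreasing_set_cvg_integral => //.
  - move=> m n mn; apply/subsetPset => z; rewrite /S /= !in_itv/= => /andP[+ ->].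
    rewrite andbT; apply: le_trans; rewrite lerD2l /u ler_pM2l//.
    by rewrite lef_pV2 ?posrE// ler_nat.
  - by move=> n; exact: measurable_itv.
  - by move=> n; exact: mf.
  - by move=> n z _; rewrite lee_fin powR_ge0.
have cvU : u n @[n --> \oo] --> (0 : R).
  rewrite -(mulr0 (d - a)); apply: cvgM; first exact: cvg_cst.
  exact: cvg_harmonic.
have cvP : (u n) `^ q @[n --> \oo] --> (0 : R).
  have /cvg_at_rightP := powR_cvg0 q0.
  by apply; split.
have cvR : ((((d - a) `^ q - (u n) `^ q) / q)%:E @[n --> \oo] -->
    (((d - a) `^ q - (a - a) `^ q) / q)%:E).
  apply: cvg_EFin; first exact: nearW.
  apply: cvgM; last exact: cvg_cst.
  rewrite subrr powR0//; apply: cvgB; last exact: cvP.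
  exact: cvg_cst.
have E : (fun n => \int[mu]_(s in S n) ((s - a) `^ (q - 1))%:E)%E =
    (fun n => (((d - a) `^ q - (u n) `^ q) / q)%:E).
  apply/funext => n; rewrite /S integral_shift_powR_lt//; last by rewrite ltrDl.
  by rewrite addrAC subrr add0r.
rewrite E in cvS; apply: (cvg_unique _ cvS cvR); exact: ereal_hausdorff.
Qed.

(** Two-term Hoelder inequality for the splittings d^be = (d^be - c^be) + c^be and d = (d - c) + c,
    with be = 1 - p al. Since be/p + 1/q = 1 - al, the right side is d^(1-al) and the second term on
    the left c^(1-al). *)
Lemma powR_increment_hoelder (p al c d : R) : 1 < p -> 0 < al -> p * al < 1 ->
  0 <= c -> c <= d ->
  (d `^ (1 - p * al) - c `^ (1 - p * al)) * (d - c) `^ (p - 1) <=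
  (d `^ (1 - al) - c `^ (1 - al)) `^ p.
Proof.
move=> p1 al0 pal c0 cd; have d0 : 0 <= d by lra.
have p0 : 0 < p by lra.
have pm0 : 0 < p - 1 by lra.
set be := 1 - p * al; have be0 : 0 < be by rewrite /be; lra.
pose q := p / (p - 1); have q0 : 0 < q by rewrite divr_gt0.
have D0 : 0 <= d `^ be - c `^ be.
  by rewrite subr_ge0; apply: ge0_ler_powR; rewrite ?nnegrE// ltW.
have dc : 0 <= d - c by rewrite subr_ge0.
have pn0 : p != 0 by rewrite gt_eqF.
have qn0 : q != 0 by rewrite gt_eqF.
have := @hoelder2 R ((d `^ be - c `^ be) `^ p^-1) ((c `^ be) `^ p^-1)
  ((d - c) `^ q^-1) (c `^ q^-1) p q (powR_ge0 _ _) (powR_ge0 _ _)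
  (powR_ge0 _ _) (powR_ge0 _ _) p0 q0.
have pq : p^-1 + q^-1 = 1 by rewrite /q; field; rewrite !gt_eqF.
move=> /(_ pq); rewrite -!(powRrM _ p^-1) -!(powRrM _ q^-1) !mulVf//.
rewrite !powRr1 ?powR_ge0// !subrK.
have E z : 0 <= z -> (z `^ be) `^ p^-1 * z `^ q^-1 = z `^ (1 - al).
  move=> z0; rewrite -powRrM -powRD.
    by congr powR; rewrite /be /q; field; rewrite !gt_eqF.
  apply/implyP => /eqP h; exfalso; move: h.
  have : 0 < be * p^-1 + q^-1 by rewrite addr_gt0 ?mulr_gt0 ?invr_gt0.
  by move=> /[swap] ->; rewrite ltxx.
move=> H0; have H : (d `^ be - c `^ be) `^ p^-1 * (d - c) `^ q^-1 <=
    d `^ (1 - al) - c `^ (1 - al).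
  by rewrite lerBrDr -(E c c0) -(E d d0).
have Hp : ((d `^ be - c `^ be) `^ p^-1 * (d - c) `^ q^-1) `^ p =
    (d `^ be - c `^ be) * (d - c) `^ (p - 1).
  rewrite powRM ?powR_ge0// -!powRrM mulVf// powRr1//; congr (_ * _ `^ _).
  by rewrite /q; field; rewrite !gt_eqF.
rewrite -Hp; apply: ge0_ler_powR => //; rewrite ?nnegrE ?(ltW p0)//.
  by rewrite mulr_ge0 ?powR_ge0.
by apply: le_trans H; rewrite mulr_ge0 ?powR_ge0.
Qed.
End Power.

Section Extremal.
Context {R : realType}.
Local Notation mu := (@lebesgue_measure R).

Lemma mean_shift_powR (a q c d : R) b1 b2 : 0 < q -> a <= c -> c < d ->
  mean (fun s => (s - a) `^ (q - 1)) [set` Interval (BSide b1 c) (BSide b2 d)] =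
  (((d - a) `^ q - (c - a) `^ q) / q / (d - c))%:E.
Proof.
move=> q0 ac cd; rewrite mean_borel//; first by rewrite integral_shift_powR.
- exact: measurable_shift_powR.
- by move=> s; exact: powR_ge0.
Qed.

(** Where 0 < s - a <= 1 the integrand dominates (s-a)^(e-1) for every e > 0. The integral of the
    latter up to a + m is m^e/e, at least m/e for e <= 1, hence unbounded as e tends to 0. *)
Lemma mean_shift_powR_infty (a q b : R) b1 b2 : q <= 0 -> a < b ->
  mean (fun s => (s - a) `^ (q - 1)) [set` Interval (BSide b1 a) (BSide b2 b)] = +oo%E.
Proof.
move=> q0 ab; rewrite mean_borel//; last 2 first.
- exact: measurable_shift_powR.
- by move=> s; exact: powR_ge0.
suff -> : (\int[mu]_(s in `]a, b]) ((s - a) `^ (q - 1))%:E = +oo)%E.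
  by rewrite gt0_mulye ?lte_fin ?invr_gt0 ?subr_gt0.
pose m : R := Num.min (b - a) 1.
have m0 : 0 < m by rewrite lt_min subr_gt0 ab ltr01.
have m1 : m <= 1 by rewrite ge_min lexx orbT.
pose am : R := a + m.
have amb : am <= b by rewrite -lerBrDl ge_min lexx.
have mf D r : measurable_fun D (fun s : R => ((s - a) `^ r)%:E).
  by apply: measurable_funTS; apply/measurable_EFinP; exact: measurable_shift_powR.
have lb (e : R) : 0 < e <= 1 ->
    ((m / e)%:E <= \int[mu]_(s in `]a, b]) ((s - a) `^ (q - 1))%:E)%E.
  move=> /andP[e0 e1].
  have h1 : (\int[mu]_(s in `]a, am]) ((s - a) `^ (q - 1))%:E <=
      \int[mu]_(s in `]a, b]) ((s - a) `^ (q - 1))%:E)%E.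
    apply: ge0_subset_integral => //.
    - exact: mf.
    - by move=> z _; rewrite lee_fin powR_ge0.
    - by move=> z; rewrite /= !in_itv/= => /andP[-> /le_trans->].
  have h2 : (\int[mu]_(s in `]a, am]) ((s - a) `^ (e - 1))%:E <=
      \int[mu]_(s in `]a, am]) ((s - a) `^ (q - 1))%:E)%E.
    apply: ge0_le_integral => //.
    - by move=> s _; rewrite lee_fin powR_ge0.
    - exact: mf.
    - exact: mf.
    - move=> s; rewrite /= in_itv/= => /andP[sa sm]; rewrite lee_fin.
      apply: (@ger_powR _ (s - a)); last lra.
      by rewrite subr_gt0 sa/= lerBlDl (le_trans sm)// lerD2l.
  apply: le_trans (le_trans h2 h1).
  rewrite integral_shift_powR//; last by rewrite ltrDl.
  rewrite subrr powR0 ?gt_eqF// subr0 /am addrAC subrr add0r lee_fin.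
  rewrite ler_pM2r ?invr_gt0//.
  by have := @ger_powR R m; rewrite m0 m1 => /(_ isT e 1 e1); rewrite powRr1// ltW.
apply/eqyP => A A0.
pose e := Num.min 1 (m / A).
have e0 : 0 < e by rewrite lt_min ltr01 divr_gt0.
apply: le_trans (lb e _); last by rewrite e0 ge_min lexx.
by rewrite lee_fin ler_pdivlMr// mulrC -ler_pdivlMr// ge_min lexx orbT.
Qed.
Lemma subset_itv_left (a b c d : R) b1 b2 b3 b4 : c < d ->
  [set` Interval (BSide b3 c) (BSide b4 d)] `<=`
    [set` Interval (BSide b1 a) (BSide b2 b)] ->
  a <= c.
Proof.
move=> cd JI; rewrite leNgt; apply/negP => ca.
(* If c < a, this point belongs to the smaller interval but lies to the left of [a]. *)
pose z := (c + Num.min a d) / 2.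
have cm : c < Num.min a d by rewrite lt_min ca.
have md : Num.min a d <= d by rewrite ge_min lexx orbT.
have ma : Num.min a d <= a by rewrite ge_min lexx.
have cz : c < z by rewrite /z; lra.
have zd : z < d by rewrite /z; lra.
have za : z < a by rewrite /z; lra.
have /JI : [set` Interval (BSide b3 c) (BSide b4 d)] z.
  by rewrite /= in_itv/= (lteifS _ cz) (lteifS _ zd).
rewrite /= in_itv/= => /andP[+ _] => /lteifW.
by rewrite leNgt za.
Qed.

Section PowerWeight.
Variables (a b p delta x : R) (b1 b2 : bool).
Let I := [set` Interval (BSide b1 a) (BSide b2 b)].
Let w (s : R) := (s - a) `^ (- x^-1).

Lemma power_weight_powE (t : R) :
  (fun s => w s `^ t) = (fun s => (s - a) `^ ((1 - t * x^-1) - 1)).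
Proof. by apply/funext => s; rewrite /w -powRrM; congr powR; ring. Qed.

Lemma power_weightE : w = (fun s => (s - a) `^ ((1 - x^-1) - 1)).
Proof. by apply/funext => s; rewrite /w; congr powR; ring. Qed.

(** The means are explicit. With al = 1/x, the relation between [x] and [delta] makes delta^p equal
    to (1-al)^p/(1-p al), and the class condition becomes [powR_increment_hoelder] at c - a and d -
    a. *)
Lemma power_weight_RH : 1 < p -> p < x -> 0 <= delta ->
  (x - p) * delta `^ p = x * ((x - 1) / x) `^ p -> RH p delta I w.
Proof.
move=> p1 px d0 dE.
have p0 : 0 < p by lra.
have x0 : 0 < x by lra.
have x1 : 0 < x - 1 by lra.
have xp : 0 < x - p by lra.
have xi0 : 0 < x^-1 by rewrite invr_gt0.
have pxi : p * x^-1 < 1 by rewrite ltr_pdivrMr// mul1r.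
have k0 : 0 < 1 - x^-1 by rewrite subr_gt0 invf_lt1//; lra.
have be0 : 0 < 1 - p * x^-1 by lra.
split.
  split; last by move=> s _; exact: powR_ge0.
  apply: measurable_funTS; apply: measurable_fun_lebesgue => //.
  exact: measurable_shift_powR.
move=> J [bJ JI]; have [c [d [b3 [b4 [cd JE]]]]] := bounded_interval_itv bJ.
rewrite JE in JI *; have ac := subset_itv_left cd JI.
rewrite /power_mean_ratio power_weight_powE power_weightE !mean_shift_powR//.
set al := x^-1 in xi0 pxi k0 be0 *.
have D1 : 0 < (d - a) `^ (1 - al) - (c - a) `^ (1 - al).
  by rewrite subr_gt0; apply: gt0_ltr_powR; rewrite ?nnegrE//; lra.
have dc : 0 < d - c by rewrite subr_gt0.
split; first by rewrite lte_fin ltry !divr_gt0.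
have H := @powR_increment_hoelder R p al (c - a) (d - a) p1 xi0 pxi
  (ltac:(by rewrite subr_ge0)) (ltac:(by rewrite lerD2r ltW)).
rewrite (_ : d - a - (c - a) = d - c) in H; last by ring.
apply/power_mean_ratio_leP => //.
- by rewrite !divr_gt0.
- rewrite lee_fin !divr_ge0// ?(ltW dc) ?(ltW be0)// subr_ge0.
  by apply: ge0_ler_powR; rewrite ?nnegrE; lra.
rewrite lee_fin.
set D := (d - a) `^ (1 - al) - (c - a) `^ (1 - al) in D1 H *.
have kE : (x - 1) / x = 1 - al by rewrite /al; field; rewrite gt_eqF.
have dpE : delta `^ p = (1 - al) `^ p / (1 - p * al).
  apply: (mulfI (lt0r_neq0 xp)); rewrite dE kE /al; field.
  by rewrite !gt_eqF//; lra.
rewrite powRM ?divr_ge0// ?(ltW D1) ?(ltW k0) ?(ltW dc)//.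
have -> : (D / (1 - al) / (d - c)) `^ p = D `^ p / (1 - al) `^ p / (d - c) `^ p.
  rewrite !powRM ?invr_ge0 ?divr_ge0 ?(ltW D1) ?(ltW k0) ?(ltW dc)//.
  by rewrite -(powR_inv1 (ltW k0)) -(powR_inv1 (ltW dc)) -!powRrM !mulN1r !powRN.
rewrite dpE.
have kp : 0 < (1 - al) `^ p by rewrite powR_gt0.
have dcp : 0 < (d - c) `^ (p - 1) by rewrite powR_gt0.
rewrite -(@mulr_powRB1 _ (d - c) p) ?(ltW dc)//.
have -> : (1 - al) `^ p / (1 - p * al) *
    (D `^ p / (1 - al) `^ p / ((d - c) * (d - c) `^ (p - 1))) =
   D `^ p / (d - c) `^ (p - 1) / (1 - p * al) / (d - c).
  by field; rewrite !gt_eqF.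
rewrite !ler_pM2r ?invr_gt0//.
by rewrite ler_pdivlMr.
Qed.

(** The weight attains the sharp constant on [I] itself: by homogeneity the powers of b - a
    cancel. *)
Lemma power_weight_ratio (t : R) : a < b -> 1 < x -> 0 < t -> t < x ->
  power_mean_ratio t w I = ((x - 1) / x * (x / (x - t)) `^ t^-1)%:E.
Proof.
move=> ab x1 t0 tx.
have x0 : 0 < x by lra.
have xi0 : 0 < x^-1 by rewrite invr_gt0.
have xt : 0 < x - t by lra.
have txi : t * x^-1 < 1 by rewrite ltr_pdivrMr// mul1r.
have k0 : 0 < 1 - x^-1 by rewrite subr_gt0 invf_lt1//; lra.
have be0 : 0 < 1 - t * x^-1 by lra.
have L0 : 0 < b - a by rewrite subr_gt0.
rewrite /power_mean_ratio power_weight_powE power_weightE !mean_shift_powR//.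
rewrite subrr !powR0 ?gt_eqF// !subr0.
have E q : (b - a) `^ q / q / (b - a) = (b - a) `^ (q - 1) / q.
  by rewrite -(powR_mul_split q 1 L0) powRr1 ?(ltW L0)// mulrAC mulfK// gt_eqF.
rewrite !E addrAC subrr add0r [1 - x^-1 - 1]addrAC subrr add0r.
have kinv : (x - 1) / x = 1 - x^-1 by field; rewrite gt_eqF.
have tinv : x / (x - t) = (1 - t * x^-1)^-1 by field; rewrite !gt_eqF//; lra.
rewrite poweR_EFin powRM ?powR_ge0 ?invr_ge0 ?(ltW be0)// -powRrM.
rewrite (_ : - (t * x^-1) * t^-1 = - x^-1); last by field; rewrite !gt_eqF.
have w0 : 0 < (b - a) `^ (- x^-1) by rewrite powR_gt0.
rewrite inver gt_eqF ?divr_gt0// -EFinM kinv tinv; congr EFin.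
move: w0 k0; set W := (b - a) `^ _; set Y := (1 - t * x^-1)^-1 `^ _; set K := 1 - x^-1.
by move: W Y K => W Y K W0 K0; field; rewrite !gt_eqF.
Qed.

(** The exponent t/x is at least 1, so w^t is not integrable at [a], while [w] has a finite mean
    because x > 1. *)
Lemma power_weight_ratio_infty (t : R) : a < b -> 1 < x -> x <= t ->
  power_mean_ratio t w I = +oo%E.
Proof.
move=> ab x1 xt.
have x0 : 0 < x by lra.
have t0 : 0 < t by lra.
have k0 : 0 < 1 - x^-1 by rewrite subr_gt0 invf_lt1//; lra.
have be0 : 1 - t * x^-1 <= 0 by rewrite subr_le0 ler_pdivlMr// mul1r.
have L0 : 0 < b - a by rewrite subr_gt0.
rewrite /power_mean_ratio power_weight_powE power_weightE mean_shift_powR_infty//.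
rewrite mean_shift_powR// subrr powR0 ?gt_eqF// subr0.
rewrite poweRyr ?invr_eq0 ?gt_eqF//.
have B0 : 0 < (b - a) `^ (1 - x^-1) / (1 - x^-1) / (b - a).
  by rewrite !divr_gt0// powR_gt0.
by rewrite inver gt_eqF// gt0_mulye// lte_fin invr_gt0.
Qed.
End PowerWeight.
End Extremal.

(** * The critical exponent *)

Section Final.
Context {R : realType}.

(** Intermediate value theorem for [h], the difference of the two sides of the critical equation
    cleared of denominators. *)
Lemma critical_equation_exists (p delta : R) : 1 < p -> 1 < delta ->
  exists x, critical_equation p delta x.
Proof.
move=> p1 d1; have p0 : 0 < p by lra.
pose D := delta `^ p.
have D1 : 1 < D.
  have : 1 `^ p < delta `^ p by apply: gt0_ltr_powR; rewrite ?nnegrE//; lra.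
  by rewrite powR1.
pose h y := D * (y - p) - y * ((y - 1) / y) `^ p.
(* Chosen to solve D(X - p) = X; then [h X] is nonnegative because (X-1)/X <= 1. *)
pose X := D * p / (D - 1).
have pX : p <= X.
  by rewrite /X ler_pdivlMr ?subr_gt0// mulrC ler_wpM2r// ?ltW//; lra.
have ch : {within `[p, X], continuous h}.
  apply: continuous_in_subspaceT => z; rewrite inE/= in_itv/= => /andP[pz _].
  have z0 : 0 < z by lra.
  have zn : z != 0 by rewrite gt_eqF.
  have z1 : 0 < (z - 1) / z by rewrite divr_gt0//; lra.
  apply: cvgB.
    by apply: cvgM; [exact: cvg_cst | apply: cvgB; [exact: cvg_id|exact: cvg_cst]].
  apply: cvgM; first exact: cvg_id.
  apply: (@cvg_comp _ _ _ (fun y => (y - 1) / y) (fun y => y `^ p) _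
    (nbhs ((z - 1) / z))).
    apply: cvgM; first by apply: cvgB; [exact: cvg_id|exact: cvg_cst].
    exact: cvgV.
  exact: continuous_powR_gt0.
have hp : h p <= 0.
  by rewrite /h subrr mulr0 sub0r oppr_le0 mulr_ge0 ?powR_ge0// ltW.
have hX : 0 <= h X.
  have X0 : 0 < X by lra.
  rewrite /h subr_ge0.
  have -> : D * (X - p) = X by rewrite /X; field; rewrite gt_eqF// subr_gt0.
  rewrite ler_piMr ?(ltW X0)//.
  have X1 : 0 <= (X - 1) / X by rewrite divr_ge0 ?(ltW X0)//; lra.
  have : ((X - 1) / X) `^ p <= 1 `^ p.
    apply: ge0_ler_powR; rewrite ?nnegrE// ?(ltW p0)//.
    by rewrite ler_pdivrMr// mul1r; lra.
  by rewrite powR1.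
have [|x] := @IVT R h p X 0 pX ch; first by rewrite ge_min le_max hp hX orbT.
rewrite in_itv/= => /andP[px _] hx.
have x0 : 0 < x by lra.
have x1 : 0 < x - 1 by lra.
have k0 : 0 < (x - 1) / x by rewrite divr_gt0.
exists x; split.
  (* The root differs from [p], as h p = -p((p-1)/p)^p is nonzero. *)
  rewrite lt_neqAle px andbT; apply/negP => /eqP E; move: hx.
  rewrite -E /h subrr mulr0 sub0r.
  rewrite E; apply/eqP; rewrite oppr_eq0 mulf_neq0 ?gt_eqF// powR_gt0//.
rewrite -mulrA (_ : x / (x - 1) = ((x - 1) / x)^-1); last by rewrite invf_div.
rewrite powRM ?invr_ge0 ?(ltW k0)//; last by lra.
rewrite -/D -(powR_inv1 (ltW k0)) -powRrM mulN1r powRN.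
have kp : 0 < ((x - 1) / x) `^ p by rewrite powR_gt0.
move/eqP: hx; rewrite /h subr_eq0 => /eqP hx.
rewrite mulrA [_ * (x - p)]mulrAC hx.
by field; rewrite !gt_eqF.
Qed.

Lemma critical_equationE (p delta x : R) : 1 < p -> 0 <= delta ->
  critical_equation p delta x ->
  p < x /\ (x - p) * delta `^ p = x * ((x - 1) / x) `^ p.
Proof.
move=> p1 d0 [px]; split => //.
have x0 : 0 < x by lra.
have x1 : 0 < x - 1 by lra.
have k0 : 0 < (x - 1) / x by rewrite divr_gt0.
have kp : 0 < ((x - 1) / x) `^ p by rewrite powR_gt0.
move: b; rewrite -mulrA (_ : x / (x - 1) = ((x - 1) / x)^-1); last by rewrite invf_div.
rewrite powRM ?invr_ge0 ?(ltW k0)//.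
rewrite -(powR_inv1 (ltW k0)) -powRrM mulN1r powRN.
set K := ((x - 1) / x) `^ p in kp *; set D := delta `^ p => /(congr1 (fun z => z * (x * K))).
rewrite mul1r => <-; field; by rewrite !gt_eqF.
Qed.

(** At t = p the sharp constant is [delta], so this end of the range is the class condition
    itself. *)
Lemma critical_delta (p delta x : R) : 1 < p -> 0 <= delta -> p < x ->
  (x - p) * delta `^ p = x * ((x - 1) / x) `^ p ->
  (x - 1) / x * (x / (x - p)) `^ p^-1 = delta.
Proof.
move=> p1 d0 px E.
have p0 : 0 < p by lra.
have x0 : 0 < x by lra.
have xp : 0 < x - p by lra.
have k0 : 0 <= (x - 1) / x by rewrite divr_ge0//; lra.
have xx : 0 <= x / (x - p) by rewrite divr_ge0// ltW.
have pn : p != 0 by rewrite gt_eqF.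
rewrite -[RHS](powRr1 d0) -(mulfV pn) powRrM.
have -> : delta `^ p = ((x - 1) / x) `^ p * (x / (x - p)).
  apply: (mulfI (lt0r_neq0 xp)); rewrite E.
  by field; rewrite !gt_eqF.
by rewrite (powRM _ (powR_ge0 _ _) xx) -powRrM mulfV// powRr1.
Qed.

Lemma RH1_power_mean_ratio_le1 (I J : set R) (w : R -> R) (p t : R) :
  1 < p -> p < t -> bounded_interval I -> RH p 1 I w -> subinterval I J ->
  (power_mean_ratio t w J <= 1)%E.
Proof.
move=> p1 pt bI hw sJ; apply/lee_addgt0Pr => e e0.
have t0 : 0 < t by lra.
have t1 : 1 < t by lra.
(* Chosen so that x/(x-t) = 1 + e. *)
pose x := t + t / e.
have te : 0 < t / e by rewrite divr_gt0.
have tx : t < x by rewrite /x; lra.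
have x0 : 0 < x by lra.
have xt : 0 < x - t by lra.
have Dx : (x - p) * 1 `^ p <= x * ((x - 1) / x) `^ p.
  rewrite powR1 mulr1.
  have k0 : 0 <= (x - 1) / x by rewrite divr_ge0//; lra.
  (* Bernoulli's inequality: ((x-1)/x)^p >= 1 - p/x. *)
  have := @powR_tangent R p ((x - 1) / x) 1 p1 k0 ltr01.
  rewrite !powR1 mulr1 => /(ler_wpM2l (ltW x0)); apply: le_trans.
  rewrite le_eqVlt; apply/orP; left; apply/eqP; field; rewrite gt_eqF//.
apply: (le_trans (RH_power_mean_ratio_le p1 pt tx (lexx 1) Dx bI hw sJ)).
rewrite -EFinD lee_fin.
have xtE : x - t = t / e by rewrite /x; ring.
have -> : 1 + e = x / (x - t) by rewrite xtE /x; field; rewrite !gt_eqF.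
have X1 : 1 <= x / (x - t) by rewrite ler_pdivlMr// mul1r; lra.
have k1 : (x - 1) / x <= 1 by rewrite ler_pdivrMr// mul1r; lra.
apply: (@le_trans _ _ ((x / (x - t)) `^ t^-1)).
  by rewrite ler_piMl ?powR_ge0.
by apply: ler1_powR => //; rewrite invf_le1// ltW.
Qed.

(** The constant weight is the extremal one for delta = 1. *)
Lemma RH1_cst (p : R) a b b1 b2 : 0 < p -> a < b ->
  RH p 1 [set` Interval (BSide b1 a) (BSide b2 b)] (cst (1 : R)) /\
  (forall t, power_mean_ratio t (cst (1 : R))
    [set` Interval (BSide b1 a) (BSide b2 b)] = 1%E).
Proof.
move=> p0 ab.
have m1 c d b3 b4 : c < d ->
    mean (cst (1 : R)) [set` Interval (BSide b3 c) (BSide b4 d)] = 1%E.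
  move=> cd; rewrite mean_borel//.
  have -> : (\int[lebesgue_measure]_(s in `]c, d]) (cst (1 : R) s)%:E =
      1%E * lebesgue_measure (`]c, d]%classic : set R))%E.
    by apply: (integral_cst _ _ 1%E).
  rewrite mul1e lebesgue_measure_itv/= lte_fin cd.
  by rewrite -EFinB -EFinM mulfV// gt_eqF// subr_gt0.
have r1 t c d b3 b4 : c < d ->
    power_mean_ratio t (cst (1:R)) [set` Interval (BSide b3 c) (BSide b4 d)] = 1%E.
  move=> cd; rewrite /power_mean_ratio.
  rewrite (_ : (fun s => cst (1 : R) s `^ t) = cst (1 : R)); last first.
    by apply/funext => s /=; rewrite powR1.
  by rewrite m1// poweR1r inver oner_eq0 invr1 mule1.
split; last by move=> t; exact: r1.
split; first by split=> [|s _]; [exact: measurable_cst | exact: ler01].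
move=> J [/bounded_interval_itv[c [d [b3 [b4 [cd ->]]]]] _].
by rewrite m1// r1// lte01 ltry.
Qed.
End Final.

Theorem theorem3 (R : realType) (I : set R) (p delta t : R)
    (hI : bounded_interval I) (hp : 1 < p) (hdelta : 1 <= delta) (ht : p <= t) :
  (forall w : R -> R, RH p delta I w ->
     (ereal_sup [set power_mean_ratio t w J | J in subinterval I]
        <= sharp_constant t p delta)%E) /\
  (forall C : \bar R,
     (forall w : R -> R, RH p delta I w ->
        (ereal_sup [set power_mean_ratio t w J | J in subinterval I] <= C)%E) ->
     (sharp_constant t p delta <= C)%E).
Proof.
have p0 : 0 < p by lra.
have t0 : 0 < t by lra.
have d0 : 0 <= delta by lra.
have sI : subinterval I I by split.
have [a [b [b1 [b2 [ab IE]]]]] := bounded_interval_itv hI.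
(* [I] is one of its own subintervals, so sharpness only needs the ratio of the extremal weight on
   [I]. *)
have lb w C : (ereal_sup [set power_mean_ratio t w J | J in subinterval I] <= C)%E ->
    (power_mean_ratio t w I <= C)%E.
  by apply: le_trans; apply: ereal_sup_ubound; exists I.
rewrite /sharp_constant /critical_exponent; case: eqP => [d1|/eqP dn1].
  subst delta; split=> [w hw|C hC].
    apply: ub_ereal_sup => _ [J sJ <-].
    (* At t = p the claim is the defining condition of the class; only t > p needs the higher
       integrability bound. *)
    move: ht; case: ltgtP => // [pt|<-] _; last exact: (hw.2 J sJ).2.
    exact: (RH1_power_mean_ratio_le1 hp pt hI hw sJ).
  have [h1 h2] := RH1_cst b1 b2 p0 ab; rewrite -IE in h1 h2.
  by rewrite -(h2 t); apply: lb; exact: hC.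
have d1 : 1 < delta by rewrite lt_neqAle eq_sym dn1.
set x := xget _ _.
have [px E] : p < x /\ (x - p) * delta `^ p = x * ((x - 1) / x) `^ p.
  apply: critical_equationE => //; rewrite /x.
  have [y hy] := critical_equation_exists hp d1.
  exact: (@xgetPex _ 0 [set x | critical_equation p delta x]) (ex_intro _ y hy).
have x1 : 1 < x by lra.
(* One power weight gives sharpness both below the critical exponent and from it onwards. *)
have hw := @power_weight_RH R a b p delta x b1 b2 hp px d0 E.
rewrite -IE in hw.
case: ltP => [tx|xt]; last first.
  split=> [w _|C hC]; first by rewrite leey.
  rewrite -(@power_weight_ratio_infty R a b x b1 b2 t ab x1 xt) -IE.
  by apply: lb; exact: hC.
split=> [w hw'|C hC]; last first.
  rewrite -(@power_weight_ratio R a b x b1 b2 t ab x1 t0 tx) -IE.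
  by apply: lb; exact: hC.
apply: ub_ereal_sup => _ [J sJ <-].
move: ht; case: ltgtP => // pt _.
  by apply: (RH_power_mean_ratio_le hp pt tx hdelta _ hI hw' sJ); rewrite E.
by subst t; rewrite (critical_delta hp d0 px E); exact: (hw'.2 J sJ).2.
Qed.
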